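(* Let $\mathcal D$ be an open subset of $\mathbb R^n_{q-1}$, let $F:\mathcal D\to\mathbb R$ be a nowhere vanishing smooth function whose graph $$M=\{(F(u^1,\dots,u^n),u^1,\dots,u^n):(u^1,\dots,u^n)\in\mathcal D\}\subset\mathbb R^{n+1}_q$$ is a null hypersurface (a Monge null hypersurface), and endow $M$ with the rigging $$\mathscr N_F=\frac1{\sqrt2}\Big[-\frac{\partial}{\partial x^0}+\sum_{a=1}^n\varepsilon^aF'_{u^a}\frac{\partial}{\partial x^a}\Big].$$ Then the following hold. (1) The rigging $\mathscr N_F$ is closed and the corresponding rotation $1$-form $\tau^{\mathscr N_F}$ vanishes identically. (2) The screen distribution is conformal with conformal factor $\varphi=1$, i.e. $A_{\mathscr N_F}=\stackrel{\star}{A}_{\xi_F}$. (3) The screen distribution is integrable, with leaves the level sets of the function $F$ (viewed in $M$ through the graph parametrization). (4) The induced connection $\nabla$ coincides with the Levi-Civita connection of the associated metric $g_1=g+\eta\otimes\eta$. (5) In the natural basis $\{\partial/\partial u^a\}_a$, the divergence with respect to the induced connection of a vector field $X=\sum_aX^a\frac{\partial}{\partial u^a}$ on $M$, i.e. the trace of $Y\mapsto\nabla_YX$, is $$\operatorname{div}X=\sum_{a=1}^n\frac{\partial X^a}{\partial u^a}.$$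
   Context: $\mathbb R^{n+1}_q$ ($q>0$) is $\mathbb R^{n+1}$ with coordinates $(x^0,\dots,x^n)$ and metric $\overline g=\sum_{i=0}^n\varepsilon_i(dx^i)^2$, where $\varepsilon^i=\varepsilon_i=-1$ for $0\le i\le q-1$ and $\varepsilon^i=\varepsilon_i=+1$ for $q\le i\le n$; $\mathbb R^n_{q-1}$ is $\mathbb R^n$ with coordinates $(u^1,\dots,u^n)$ and metric $\sum_{a=1}^n\varepsilon_a(du^a)^2$. $F'_{u^a}=\partial F/\partial u^a$. The graph $M$ with induced metric $g=x^\star\overline g$ ($x$ the inclusion) is null, i.e. $g$ is degenerate at every point, iff $\sum_a\varepsilon^a(F'_{u^a})^2=1$ on $\mathcal D$. On $M$, $\frac{\partial}{\partial u^a}=F'_{u^a}\frac{\partial}{\partial x^0}+\frac{\partial}{\partial x^a}$ is the coordinate frame of the graph parametrization. For a null hypersurface $M$, a null rigging $N$ is a vector field defined on an open set containing $M$, lightlike along $M$ and with $N_p\notin T_pM$ for $p\in M$. Put $\overline\eta=\overline g(N,\cdot)$, $\eta=x^\star\overline\eta$; the screen distribution is $\ker\eta\subset TM$; the rigged vector field $\xi$ is the unique section of $TM^\perp\subset TM$ with $\overline g(\xi,N)=1$ (for $\mathscr N_F$ it is $\xi_F=\frac1{\sqrt2}[\partial_{x^0}+\sum_a\varepsilon^aF'_{u^a}\partial_{x^a}]$). With $\overline\nabla$ the Levi-Civita connection of $\overline g$, the induced connection $\nabla$, second fundamental form $B$, shape operators $A_N,\stackrel{\star}{A}_\xi$ (with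 values in $\ker\eta$) and rotation $1$-form $\tau=\tau^N$ are defined, for $X,Y\in\Gamma(TM)$, by $$\overline\nabla_XY=\nabla_XY+B(X,Y)N,\quad \overline\nabla_XN=-A_NX+\tau(X)N,\quad \nabla_X\xi=-\stackrel{\star}{A}_\xi X-\tau(X)\xi.$$ The rigging is closed if $d\eta=0$; the screen distribution is conformal with conformal factor $\varphi$ if $A_N=\varphi\stackrel{\star}{A}_\xi$ with $\varphi$ a nowhere vanishing smooth function. *)

(* Defs.v *)
From mathcomp Require Import all_boot all_order all_algebra.
From mathcomp Require Import all_classical all_reals all_analysis.
Set Implicit Arguments.
Unset Strict Implicit.
Unset Printing Implicit Defensive.
Import Order.TTheory GRing.Theory Num.Theory numFieldNormedType.Exports.
Local Open Scope classical_set_scope.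
Local Open Scope ring_scope.

Definition coord_vec {R : realType} {m : nat} (i : 'I_m) : 'rV[R]_m :=
  delta_mx ord0 i.

Definition partial {R : realType} {m : nat} {V : normedModType R} (i : 'I_m)
    (f : 'rV[R]_m -> V) : 'rV[R]_m -> V :=
  'D_(coord_vec i) f.

(* C^infty: partial derivatives of all orders exist and are continuous on D.
   The values of f outside D are irrelevant when D is open. *)
Definition smooth_on {R : realType} {m : nat} {V : normedModType R}
    (D : set 'rV[R]_m) (f : 'rV[R]_m -> V) : Prop :=
  forall (s : seq 'I_m) (u : 'rV[R]_m), D u ->
    {for u, continuous (foldr partial f s)} /\
    forall i : 'I_m, derivable (foldr partial f s) u (coord_vec i).

(* A vector field on D is a function 'rV_n -> 'rV_n, through its components in
   the natural frame; a 1-form w is given by w u v, the value at the point u on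
   the tangent vector v, and likewise for bilinear forms. *)

Section OpenSubset.
Context {R : realType} {n : nat}.
Implicit Types (D : set 'rV[R]_n) (X Y Z : 'rV[R]_n -> 'rV[R]_n).

(* d w (v1, v2) at u, computed with v1 and v2 extended as constant fields. *)
Definition ext_deriv (w : 'rV[R]_n -> 'rV[R]_n -> R) (u v1 v2 : 'rV[R]_n) : R :=
  'D_v1 (fun p => w p v2) u - 'D_v2 (fun p => w p v1) u.

Definition closed_form D (w : 'rV[R]_n -> 'rV[R]_n -> R) : Prop :=
  forall u v1 v2, D u -> ext_deriv w u v1 v2 = 0.

Definition lie_bracket X Y : 'rV[R]_n -> 'rV[R]_n :=
  fun u => 'D_(X u) Y u - 'D_(Y u) X u.

Definition affine_connection D
    (nabla : ('rV[R]_n -> 'rV[R]_n) -> ('rV[R]_n -> 'rV[R]_n) ->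
             'rV[R]_n -> 'rV[R]_n) : Prop :=
  forall X Y Z (f : 'rV[R]_n -> R),
    smooth_on D X -> smooth_on D Y -> smooth_on D Z -> smooth_on D f ->
    smooth_on D (nabla X Y) /\
    forall u, D u ->
      [/\ nabla (fun p => X p + Y p) Z u = nabla X Z u + nabla Y Z u,
          nabla (fun p => f p *: X p) Y u = f u *: nabla X Y u,
          nabla X (fun p => Y p + Z p) u = nabla X Y u + nabla X Z u
        & nabla X (fun p => f p *: Y p) u =
            f u *: nabla X Y u + 'D_(X u) f u *: Y u].

Definition semi_riemannian D (h : 'rV[R]_n -> 'rV[R]_n -> 'rV[R]_n -> R) : Prop :=
  (forall v w, smooth_on D (fun u => h u v w)) /\
  forall u, D u ->
    [/\ forall v w, h u v w = h u w v,
        forall (c : R) v v' w, h u (c *: v + v') w = c * h u v w + h u v' w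
      & forall v, (forall w, h u v w = 0) -> v = 0].

Definition levi_civita D (h : 'rV[R]_n -> 'rV[R]_n -> 'rV[R]_n -> R)
    (nabla : ('rV[R]_n -> 'rV[R]_n) -> ('rV[R]_n -> 'rV[R]_n) ->
             'rV[R]_n -> 'rV[R]_n) : Prop :=
  [/\ semi_riemannian D h,
      affine_connection D nabla,
      forall X Y u, smooth_on D X -> smooth_on D Y -> D u ->
        nabla X Y u - nabla Y X u = lie_bracket X Y u
    & forall X Y Z u, smooth_on D X -> smooth_on D Y -> smooth_on D Z -> D u ->
        'D_(X u) (fun p => h p (Y p) (Z p)) u =
          h u (nabla X Y u) (Z u) + h u (Y u) (nabla X Z u)].

(* Integral manifolds of a distribution S of rank n - 1: embedded hypersurfaces
   of D, locally the zero set of a submersion phi, with tangent space ker d phi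
   equal to S at every point. *)
Definition integral_manifold D (S : 'rV[R]_n -> set 'rV[R]_n)
    (L : set 'rV[R]_n) : Prop :=
  L `<=` D /\
  forall p, L p -> exists (U : set 'rV[R]_n) (phi : 'rV[R]_n -> R),
    [/\ open U, U p & U `<=` D] /\
    [/\ smooth_on U phi,
        forall u, U u -> exists v, 'D_v phi u != 0,
        L `&` U = U `&` phi @^-1` [set 0]
      & forall u, L u -> U u -> S u = [set v | 'D_v phi u = 0]].

Definition integrable_distribution D (S : 'rV[R]_n -> set 'rV[R]_n) : Prop :=
  forall u, D u -> exists L, integral_manifold D S L /\ L u.

(* Leaves are maximal connected integral manifolds.  Only embedded ones are
   considered; in general a leaf is merely immersed. *)
Definition leaf D (S : 'rV[R]_n -> set 'rV[R]_n) (L : set 'rV[R]_n) : Prop :=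
  [/\ L !=set0, integral_manifold D S L, connected L
    & forall L', integral_manifold D S L' -> connected L' -> L `<=` L' -> L' = L].

Definition level_set D (F : 'rV[R]_n -> R) (c : R) : set 'rV[R]_n :=
  D `&` F @^-1` [set c].

End OpenSubset.

(* The coordinates x^0, ..., x^n are indexed by 'I_n.+1.  The coordinates
   u^1, ..., u^n are indexed by 'I_n, so that a : 'I_n stands for u^{a+1},
   matched with x^{a+1}, whose index is lift ord0 a. *)

Definition eps {R : realType} (q i : nat) : R := if (i < q)%N then -1 else 1.

Definition gbar {R : realType} {n : nat} (q : nat) (v w : 'rV[R]_n.+1) : R :=
  \sum_(i < n.+1) eps q i * v ord0 i * w ord0 i.

(* A hypersurface M = x(D) is handled through its parametrization x: points and
   tangent vectors of M are points and tangent vectors of D, tangent vectors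
   being pushed into R^{n+1} by d x, and a vector field along M is a function
   of u in D.  As R^{n+1}_q is flat, the pull-back of its Levi-Civita connection
   is the directional derivative. *)

Section Hypersurface.
Context {R : realType} {n : nat}.
Context (q : nat) (D : set 'rV[R]_n) (x : 'rV[R]_n -> 'rV[R]_n.+1).

Definition push (u v : 'rV[R]_n) : 'rV[R]_n.+1 := 'D_v x u.

Definition nabla_bar (u v : 'rV[R]_n) (V : 'rV[R]_n -> 'rV[R]_n.+1) :
  'rV[R]_n.+1 := 'D_v V u.

Definition induced_metric (u v w : 'rV[R]_n) : R :=
  gbar q (push u v) (push u w).

Definition null_hypersurface : Prop :=
  forall u, D u ->
    exists2 v, v != 0 & forall w, induced_metric u v w = 0.

(* N is a vector field on an open subset of R^{n+1}. *)
Definition null_rigging (N : 'rV[R]_n.+1 -> 'rV[R]_n.+1) : Prop :=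
  (exists U : set 'rV[R]_n.+1, [/\ open U, x @` D `<=` U & smooth_on U N]) /\
  forall u, D u ->
    [/\ N (x u) != 0, gbar q (N (x u)) (N (x u)) = 0
      & ~ exists v, push u v = N (x u)].

Context (N : 'rV[R]_n.+1 -> 'rV[R]_n.+1).

Definition eta (u v : 'rV[R]_n) : R := gbar q (N (x u)) (push u v).

Definition screen (u : 'rV[R]_n) : set 'rV[R]_n := [set v | eta u v = 0].

Definition associated_metric (u v w : 'rV[R]_n) : R :=
  induced_metric u v w + eta u v * eta u w.

(* The objects below are the solutions of their defining equations, which
   exist and are unique when N is a null rigging of the null hypersurface. *)

Definition rigged (u : 'rV[R]_n) : 'rV[R]_n :=
  get [set v | (forall w, induced_metric u v w = 0) /\
               gbar q (push u v) (N (x u)) = 1].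

Definition gauss (u v : 'rV[R]_n) (Y : 'rV[R]_n -> 'rV[R]_n) : 'rV[R]_n * R :=
  get [set zb | nabla_bar u v (fun p => push p (Y p)) =
                  push u zb.1 + zb.2 *: N (x u)].

Definition nabla_at (u v : 'rV[R]_n) (Y : 'rV[R]_n -> 'rV[R]_n) : 'rV[R]_n :=
  (gauss u v Y).1.

Definition induced_connection (X Y : 'rV[R]_n -> 'rV[R]_n) :
  'rV[R]_n -> 'rV[R]_n := fun u => nabla_at u (X u) Y.

Definition weingarten (u v : 'rV[R]_n) : 'rV[R]_n * R :=
  get [set at_ | eta u at_.1 = 0 /\
         nabla_bar u v (N \o x) = - push u at_.1 + at_.2 *: N (x u)].

Definition shape_op (u v : 'rV[R]_n) : 'rV[R]_n := (weingarten u v).1.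

Definition rotation (u v : 'rV[R]_n) : R := (weingarten u v).2.

Definition screen_shape_op (u v : 'rV[R]_n) : 'rV[R]_n :=
  get [set a | eta u a = 0 /\
         nabla_at u v rigged = - a - rotation u v *: rigged u].

Definition conformal_screen (phi : 'rV[R]_n -> R) : Prop :=
  [/\ smooth_on D phi, forall u, D u -> phi u != 0
    & forall u v, D u -> shape_op u v = phi u *: screen_shape_op u v].

Definition divergence (X : 'rV[R]_n -> 'rV[R]_n) (u : 'rV[R]_n) : R :=
  \tr (lin1_mx (fun v => nabla_at u v X)).

End Hypersurface.

Definition graph {R : realType} {n : nat} (F : 'rV[R]_n -> R) (u : 'rV[R]_n) :
    'rV[R]_n.+1 :=
  \row_(i < n.+1) if unlift ord0 i is Some a then u ord0 a else F u.

Definition graph_base {R : realType} {n : nat} (p : 'rV[R]_n.+1) : 'rV[R]_n :=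
  \row_(a < n) p ord0 (lift ord0 a).

(* Defined on R x D, independently of x^0. *)
Definition monge_rigging {R : realType} {n : nat} (q : nat)
    (F : 'rV[R]_n -> R) (p : 'rV[R]_n.+1) : 'rV[R]_n.+1 :=
  (Num.sqrt 2)^-1 *:
    (- coord_vec ord0 +
     \sum_(a < n) (eps q a.+1 * partial a F (graph_base p)) *:
        coord_vec (lift ord0 a)).

(* Main.v *)
(* For the graph x of F, d x (v) = (d F (v), v), and degeneracy of the induced
   metric says d F (G) = 1, where G = (eps_a F'_a)_a is the gradient of F.
   Differentiating this along v gives 2 Hess F (v, G) = 0.  Comparing
   components in R x R^n, all the objects have closed forms:
     eta = sqrt 2 d F,  xi = G / sqrt 2,  tau = 0,
     nabla_X Y = D_X Y + Hess F (X, Y) G / 2,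
     A_N v = A*_xi v = - D_v G / sqrt 2,
     g_1 (v, w) = sum_a eps_a v_a w_a + d F (v) d F (w),
   and the five claims become computations based on the symmetry of Hess F.
   For the leaves, the zero set of a submersion is locally connected by
   Lipschitz paths, along which a function whose differential vanishes on the
   kernel of that of the submersion is constant.  Hence F is constant on
   connected integral manifolds, and components of level sets are again
   integral manifolds. *)

Require Import Defs.
From mathcomp Require Import all_boot all_order all_algebra.
From mathcomp Require Import all_classical all_reals all_analysis.
From mathcomp Require Import ring lra.
Import Order.TTheory GRing.Theory Num.Theory numFieldNormedType.Exports.
Local Open Scope classical_set_scope.
Local Open Scope ring_scope.

(** * Differential calculus on row vectors *)

Section Calculus.
Context {R : realType}.

(** [smooth_on] speaks only of iterated partial derivatives, so derivability along arbitrary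
    vectors, linearity of ['D_v] in [v] and symmetry of the Hessian are all extracted from the
    continuity of the partials by mean value arguments. The 2 in 2 Hess F (v, G) arises because
    differentiating dF(G) = 1 gives Hess F (v, G) and dF(D_v G), which agree since G is dF with its
    index raised by constants. The 1/2 in nabla arises from the decomposition (h, 0) = h/2 (1, G) -
    h/2 (-1, G): the first vector is the push of G, the second is sqrt 2 times the rigging. It also
    gives B = - Hess F / sqrt 2. Lipschitz regularity of the paths suffices because only increments
    matter: where phi vanishes along a curve, d phi of an increment is of smaller order than the
    increment, and d F is a multiple of d phi. The geometric objects are picked by [get], so each
    closed form requires both a solution and its uniqueness. *)

Lemma is_derive_line (V W : normedModType R) (f : V -> W) (a v : V) (t : R) :
  derivable f (t *: v + a) v ->
  is_derive t 1 (fun s => f (s *: v + a)) ('D_v f (t *: v + a)).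
Proof.
have E : (fun h : R => h^-1 *: (((fun s => f (s *: v + a)) \o shift t) (h *: 1)
    - f (t *: v + a))) =
  (fun h : R => h^-1 *: ((f \o shift (t *: v + a)) (h *: v) - f (t *: v + a))).
  by apply/funext => h /=; rewrite [h *: 1]mulr1 scalerDl addrA.
by move=> df; split; rewrite /derivable /derive E.
Qed.

(** The segment is run over [0, 1] at speed [h], so [h] may have either sign or vanish, as
    coordinate increments do. *)
Lemma MVT_line (V : normedModType R) (f : V -> R) (a v : V) (h : R) :
  (forall s : R, 0 <= s <= 1 -> derivable f (a + (s * h) *: v) v) ->
  exists2 s : R, 0 <= s <= 1 & f (a + h *: v) - f a = h * 'D_v f (a + (s * h) *: v).
Proof.
move=> df.
pose g (s : R) := f ((s * h) *: v + a).
have dg (s : R) : s \in `[0, 1]%R -> is_derive s 1 g (h * 'D_v f ((s * h) *: v + a)).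
  rewrite in_itv /= => s01.
  have d1 : is_derive (s * h) (1:R) (fun t => f (t *: v + a)) ('D_v f ((s * h) *: v + a)).
    by apply: is_derive_line; rewrite addrC; exact: df.
  have d2 : is_derive s (1:R) (fun s : R => s * h) h.
    by apply: is_derive_eq; rewrite ?[in LHS]scaler0 ?add0r; exact: mulr1.
  have := @is_derive1_comp R (fun t => f (t *: v + a)) (fun s : R => s * h) s _ _ d1 d2.
  by rewrite mulrC.
have cg : {within `[0, 1], continuous g}.
  by apply: derivable_within_continuous => x /dg [].
have dg' (s : R) : s \in `]0, 1[%R -> is_derive s 1 g (h * 'D_v f ((s * h) *: v + a)).
  move=> s01; apply: dg; move: s01; rewrite !in_itv /=.
  by move=> /andP[/ltW -> /ltW ->].
have [s s01] := @MVT_segment R g _ 0 1 ler01 dg' cg.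
rewrite /g mul1r mul0r scale0r add0r subr0 mulr1 => E.
exists s; first by move: s01; rewrite in_itv.
by rewrite ![a + _]addrC E.
Qed.

Lemma norm_coord_le m (v : 'rV[R]_m) (i : 'I_m) : `|v ord0 i| <= `|v|.
Proof.
rewrite [leRHS]/Num.Def.normr/= mx_normrE.
exact: (le_bigmax _ (fun ij : 'I_1 * 'I_m => `|v ij.1 ij.2|) (ord0, i)).
Qed.

Lemma norm_coord_vec_le1 m (i : 'I_m) : `|coord_vec i : 'rV[R]_m| <= 1.
Proof.
rewrite [leLHS]/Num.Def.normr/= mx_normrE; apply: bigmax_le => //= -[a b] _ /=.
by rewrite /coord_vec mxE; case: (_ && _); rewrite ?normr1 ?normr0.
Qed.

Lemma row_sum_coord m (v : 'rV[R]_m) : v = \sum_i v ord0 i *: coord_vec i.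
Proof. exact: row_sum_delta. Qed.

(** The increment is performed one coordinate at a time. Each step is a mean value of one partial
    derivative at a nearby point, and continuity at [u] bounds its deviation from the value at
    [u]. *)
Lemma C1_expansion m (f : 'rV[R]_m -> R) (u : 'rV[R]_m) :
  (\forall p \near u, forall i, derivable f p (coord_vec i)) ->
  (forall i, {for u, continuous (partial i f)}) ->
  forall e, 0 < e -> \forall h \near (0 : 'rV[R]_m),
    `|f (u + h) - f u - \sum_i h ord0 i * partial i f u| <= e * `|h|.
Proof.
move=> df cf e e0.
(* At most [m] steps each contribute an error [e' * |h|]; [m.+1] keeps the quotient meaningful in
   dimension 0. *)
pose e' := e / m.+1%:R.
have e'0 : 0 < e' by rewrite divr_gt0.
have : \forall p \near u, forall i, derivable f p (coord_vec i) /\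
    `|partial i f p - partial i f u| <= e'.
  have H : \forall p \near u, forall i, `|partial i f p - partial i f u| <= e'.
    apply: (@filter_forall _ _ (fun i p => `|partial i f p - partial i f u| <= e') (nbhs u) _) => i.
    by have /cvgrPdistC_le := cf i; apply.
  by apply: filterS2 df H => p H1 H2 i; split.
move=> /nbhs_ballP[d /= d0 dP].
have near_small : \forall h \near (0 : 'rV[R]_m), `|h| < d / m.+1%:R.
  by apply: nbhs0_lt; rewrite divr_gt0.
apply: filterS near_small => h hd.
(* The displacement after moving the coordinates listed in [s]. The head of the list is moved last,
   which suits induction on [s]. *)
pose w (s : seq 'I_m) := \sum_(i <- s) h ord0 i *: coord_vec i.
have nw s : `|w s| <= (size s)%:R * `|h|.
  elim: s => [|i s IH]; first by rewrite /w big_nil normr0 mul0r.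
  rewrite /w big_cons (le_trans (ler_normD _ _))//= -natr1 mulrDl mul1r addrC.
  rewrite lerD// normrZ -[leRHS]mulr1.
  by rewrite ler_pM// ?norm_coord_le ?norm_coord_vec_le1.
have bnd s : (size s <= m)%N ->
    `|f (u + w s) - f u - \sum_(i <- s) h ord0 i * partial i f u|
      <= (size s)%:R * (e' * `|h|).
  elim: s => [|i s IH] sm.
    by rewrite /w !big_nil addr0 subrr subr0 normr0 mul0r.
  have inb (t : R) : 0 <= t <= 1 -> ball u d (u + w s + (t * h ord0 i) *: coord_vec i).
    move=> /andP[t0 t1]; rewrite -ball_normE /= opprD (opprD u) !addrA subrr sub0r.
    rewrite -opprD normrN (le_lt_trans (ler_normD _ _))//.
    apply: (@le_lt_trans _ _ ((size s).+1%:R * `|h|)).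
      rewrite -natr1 mulrDl mul1r lerD//.
      rewrite normrZ normrM (ger0_norm t0) -[leRHS]mulr1 -[`|h| as X in _ <= X * _]mul1r.
      by rewrite ler_pM ?mulr_ge0 ?ler_pM ?norm_coord_le ?norm_coord_vec_le1.
    apply: (@le_lt_trans _ _ (m.+1%:R * `|h|)).
      by rewrite ler_wpM2r// ler_nat ltnW.
    by rewrite -ltr_pdivlMl// mulrC.
  have [t t01 E] := @MVT_line _ f (u + w s) (coord_vec i) (h ord0 i)
    (fun t t01 => (dP _ (inb t t01) i).1).
  have -> : w (i :: s) = w s + h ord0 i *: coord_vec i by rewrite /w big_cons addrC.
  rewrite big_cons addrA.
  have -> : f (u + w s + h ord0 i *: coord_vec i) - f u -
      (h ord0 i * partial i f u + \sum_(j <- s) h ord0 j * partial j f u) =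
    h ord0 i * (partial i f (u + w s + (t * h ord0 i) *: coord_vec i) - partial i f u)
     + (f (u + w s) - f u - \sum_(j <- s) h ord0 j * partial j f u).
    have E' : h ord0 i * partial i f (u + w s + (t * h ord0 i) *: coord_vec i) =
      f (u + w s + h ord0 i *: coord_vec i) - f (u + w s) by rewrite E.
    rewrite mulrBr E'.
    move: (f (_ + _)) (f (u + _)) (f u) (_ * partial i f u) (\sum_(_ <- _) _).
    by move=> a b c k l; ring.
  rewrite (le_trans (ler_normD _ _))//= -natr1 mulrDl mul1r addrC.
  rewrite lerD ?IH ?(ltnW sm)// normrM mulrC.
  by rewrite ler_pM ?norm_coord_le// (dP _ (inb t t01) i).2.
have := bnd (index_enum 'I_m).
rewrite /w -row_sum_coord => /(_ _)/le_trans; apply.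
  by rewrite -[index_enum _]enumT size_enum_ord.
rewrite -[index_enum _]enumT size_enum_ord mulrA ler_wpM2r//.
rewrite /e' mulrCA ler_piMr ?(ltW e0)// ler_pdivrMr// mul1r ler_nat.
exact: leqnSn.
Qed.

Lemma C1_is_derive m (f : 'rV[R]_m -> R) (u v : 'rV[R]_m) :
  (\forall p \near u, forall i, derivable f p (coord_vec i)) ->
  (forall i, {for u, continuous (partial i f)}) ->
  is_derive u v f (\sum_i v ord0 i * partial i f u).
Proof.
move=> df cf; set l := \sum_i _.
suff : (fun h => h^-1 *: ((f \o shift u) (h *: v) - f u)) @ 0^' --> l.
  by move=> H; split; [apply/cvg_ex; exists l|exact: cvg_lim].
apply/cvgrPdistC_le => e e0.
have e'0 : 0 < e / (`|v| + 1) by rewrite divr_gt0// ltr_wpDl.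
have := C1_expansion _ _ _ df cf _ e'0.
move=> /nbhs_ballP[d /= d0 dP].
near=> h.
have h0 : h != 0 by near: h; exact: nbhs_dnbhs_neq.
have hd : `|h| < d / (`|v| + 1).
  by near: h; apply: dnbhs0_lt; rewrite divr_gt0// ltr_wpDl.
have hv : `|h *: v| < d.
  rewrite normrZ; apply: (@le_lt_trans _ _ (`|h| * (`|v| + 1))).
    by rewrite ler_wpM2l// lerDl.
  by rewrite -ltr_pdivlMr// ltr_wpDl.
have := dP (h *: v); rewrite -ball_normE /= sub0r normrN => /(_ hv).
under eq_bigr do rewrite mxE -mulrA.
rewrite -mulr_sumr -/l normrZ => H.
have -> : h^-1 *: (f (h *: v + u) - f u) - l = h^-1 * (f (u + h *: v) - f u - h * l).
  by rewrite mulrBr mulKf// [_ + u]addrC.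
rewrite normrM normfV ler_pdivrMl ?normr_gt0// (le_trans H)//.
rewrite mulrCA ler_wpM2l// -mulrA ler_piMr ?(ltW e0)//.
by rewrite ler_pdivrMl ?ltr_wpDl// mulr1 lerDl.
Unshelve. all: by end_near. Qed.

Lemma continuous_row (T : topologicalType) k (Y : T -> 'rV[R]_k) (u : T) :
  (forall a, {for u, continuous (fun p => Y p ord0 a)}) -> {for u, continuous Y}.
Proof.
move=> cY; apply/cvgrPdist_le => e e0.
have : \forall p \near u, forall a, `|Y u ord0 a - Y p ord0 a| <= e.
  apply: (@filter_forall _ _ (fun a p => `|Y u ord0 a - Y p ord0 a| <= e) (nbhs u) _) => a.
  by have /cvgrPdist_le := cY a; apply.
apply: filterS => p Yp; rewrite [leLHS]/Num.Def.normr/= mx_normrE.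
apply: bigmax_le => [|[b a] _ /=]; first exact: ltW.
by rewrite !mxE ord1.
Qed.

Lemma derivable_rowP (V : normedModType R) k (Y : V -> 'rV[R]_k) u v :
  derivable Y u v <-> forall a, derivable (fun p => Y p ord0 a) u v.
Proof.
apply: iff_trans (derivable_mxP Y u v) _.
by split=> [dY a|dY b a]; [exact: dY|rewrite ord1; exact: dY].
Qed.

Lemma derive_row_coord (V : normedModType R) k (Y : V -> 'rV[R]_k) u v a :
  derivable Y u v -> 'D_v Y u ord0 a = 'D_v (fun p => Y p ord0 a) u.
Proof.
move=> dY; have E := @derive_mx R V 1 k Y u v dY.
by have := congr1 (fun M : 'rV[R]_k => M ord0 a) E; rewrite mxE.
Qed.

Lemma near_eq_on {T : topologicalType} (U : Type) (D : set T) (f g : T -> U) (u : T) :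
  open D -> (forall p, D p -> f p = g p) -> D u -> \forall p \near u, f p = g p.
Proof. by move=> oD fg Du; apply: filterS fg _; exact: open_nbhs_nbhs. Qed.

Section EqOn.
Context {V W : normedModType R} (D : set V) (f g : V -> W).
Hypotheses (oD : open D) (fg : forall p, D p -> f p = g p).

Lemma derive_eq_on u v : D u -> 'D_v f u = 'D_v g u.
Proof. by move=> Du; apply: near_eq_derive; exact: near_eq_on fg Du. Qed.

Lemma derivable_eq_on u v : D u -> derivable f u v -> derivable g u v.
Proof. by move=> Du; apply: near_eq_derivable; exact: near_eq_on fg Du. Qed.

Lemma continuous_eq_on u : D u -> {for u, continuous f} -> {for u, continuous g}.
Proof.
move=> Du fc; suff : g @ u --> g u by [].
rewrite -(fg _ Du).
apply: cvg_trans fc; apply: near_eq_cvg.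
by apply: filterS fg _; exact: open_nbhs_nbhs.
Qed.
End EqOn.

(** * Smooth functions on an open set: closure properties and symmetry of second derivatives *)

Section Smooth.
Context {m : nat} (D : set 'rV[R]_m) (oD : open D).

Section Valued.
Context {V : normedModType R}.
Implicit Types f g : 'rV[R]_m -> V.

Lemma smooth_continuous f u : smooth_on D f -> D u -> {for u, continuous f}.
Proof. by move=> sf Du; have [] := sf [::] u Du. Qed.

Lemma smooth_derivable_coord f u i : smooth_on D f -> D u -> derivable f u (coord_vec i).
Proof. by move=> sf Du; have [_] := sf [::] u Du; apply. Qed.

Lemma smooth_partial f i : smooth_on D f -> smooth_on D (partial i f).
Proof. by move=> sf s; have := sf (rcons s i); rewrite foldr_rcons. Qed.

(* Coinduction principle.  In the applications below [K] is a class closed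
   under the operation whose preservation of smoothness is to be shown, which
   avoids inductions on the order of differentiation. *)
Lemma smooth_coind (K : set ('rV[R]_m -> V)) :
  (forall f, K f -> forall u, D u ->
     {for u, continuous f} /\ forall i, derivable f u (coord_vec i)) ->
  (forall f i, K f -> exists2 g, K g & forall u, D u -> partial i f u = g u) ->
  forall f, K f -> smooth_on D f.
Proof.
move=> K1 K2 f Kf s.
suff [g Kg fg] : exists2 g, K g & forall u, D u -> g u = foldr partial f s u.
  move=> u Du; have [gc gd] := K1 _ Kg u Du; split.
    exact: continuous_eq_on fg _ Du gc.
  by move=> i; exact: derivable_eq_on fg _ _ Du (gd i).
elim: s => [|i s [g Kg fg]] /=; first by exists f.
have [h Kh gh] := K2 _ i Kg; exists h => // u Du.
by rewrite -gh//; exact: derive_eq_on fg _ _ Du.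
Qed.

Lemma smooth_eq_on f g : (forall u, D u -> f u = g u) -> smooth_on D f -> smooth_on D g.
Proof.
move=> fg sf.
apply: (smooth_coind [set h | exists2 k, smooth_on D k & forall u, D u -> k u = h u]);
  last by exists f.
- move=> h [k sk kh] u Du; split.
    exact: continuous_eq_on kh _ Du (smooth_continuous _ _ sk Du).
  by move=> i; exact: derivable_eq_on kh _ _ Du (smooth_derivable_coord _ _ i sk Du).
- move=> h i [k sk kh]; exists (partial i h) => //.
  exists (partial i k); first exact: smooth_partial.
  by move=> u Du; exact: derive_eq_on kh _ _ Du.
Qed.

Lemma smooth_cst (c : V) : smooth_on D (fun=> c).
Proof.
apply: (smooth_coind [set f | exists c, f = fun=> c]); last by exists c.
- move=> _ [d ->] u Du; split; first exact: cst_continuous.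
  by move=> i; exact: derivable_cst.
- move=> _ i [d ->]; exists (fun=> 0); first by exists 0.
  by move=> u _; rewrite /partial derive_cst.
Qed.

End Valued.

(** Sums and products are generated together because Leibniz' rule turns a product into a sum of
    products; only the joint class is stable under partial derivatives, as [smooth_coind]
    requires. *)
Inductive smooth_alg : ('rV[R]_m -> R) -> Prop :=
| smooth_alg_base f : smooth_on D f -> smooth_alg f
| smooth_algD f g : smooth_alg f -> smooth_alg g -> smooth_alg (fun u => f u + g u)
| smooth_algM f g : smooth_alg f -> smooth_alg g -> smooth_alg (fun u => f u * g u).

Lemma smooth_alg_smooth f : smooth_alg f -> smooth_on D f.
Proof.
have C1 h : smooth_alg h -> forall u, D u ->
    {for u, continuous h} /\ forall i, derivable h u (coord_vec i).
  elim=> {h} [h sh|h k _ IHh _ IHk|h k _ IHh _ IHk] u Du; first exact: (sh [::]).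
  - have [hc hd] := IHh u Du; have [kc kd] := IHk u Du; split.
      exact: continuousD hc kc.
    by move=> i; exact: derivableD.
  - have [hc hd] := IHh u Du; have [kc kd] := IHk u Du; split.
      exact: continuousM hc kc.
    by move=> i; exact: derivableM.
apply: (smooth_coind smooth_alg) => // h i.
elim=> {h} [h sh|h k Kh [h' Kh' hh'] Kk [k' Kk' kk']|h k Kh [h' Kh' hh'] Kk [k' Kk' kk']].
- by exists (partial i h) => //; apply: smooth_alg_base; exact: smooth_partial.
- exists (fun u => h' u + k' u); first exact: smooth_algD.
  move=> u Du; rewrite -hh'// -kk'//.
  by apply: deriveD; [have [_] := C1 _ Kh u Du|have [_] := C1 _ Kk u Du]; apply.
- exists (fun u => h u * k' u + k u * h' u).
    by apply: smooth_algD; exact: smooth_algM.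
  move=> u Du; rewrite -hh'// -kk'//.
  by apply: deriveM; [have [_] := C1 _ Kh u Du|have [_] := C1 _ Kk u Du]; apply.
Qed.

Implicit Types f g : 'rV[R]_m -> R.

Lemma smoothD f g : smooth_on D f -> smooth_on D g -> smooth_on D (fun u => f u + g u).
Proof.
by move=> sf sg; apply: smooth_alg_smooth; apply: smooth_algD; exact: smooth_alg_base.
Qed.

Lemma smoothM f g : smooth_on D f -> smooth_on D g -> smooth_on D (fun u => f u * g u).
Proof.
by move=> sf sg; apply: smooth_alg_smooth; apply: smooth_algM; exact: smooth_alg_base.
Qed.

Lemma smoothN f : smooth_on D f -> smooth_on D (fun u => - f u).
Proof.
move=> sf; have -> : (fun u => - f u) = (fun u => (fun=> -1) u * f u).
  by apply/funext => u; rewrite mulN1r.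
exact: (smoothM (fun=> (-1 : R)) f (smooth_cst (-1 : R)) sf).
Qed.

Lemma smooth_sum (I : Type) (r : seq I) (f : I -> 'rV[R]_m -> R) :
  (forall i, smooth_on D (f i)) -> smooth_on D (fun u => \sum_(i <- r) f i u).
Proof.
move=> sf; elim: r => [|i r IH].
  suff -> : (fun u => \sum_(i <- [::]) f i u) = (fun=> 0) by exact: smooth_cst.
  by apply/funext => u; rewrite big_nil.
have -> : (fun u => \sum_(j <- i :: r) f j u) =
    (fun u => f i u + \sum_(j <- r) f j u).
  by apply/funext => u; rewrite big_cons.
exact: (smoothD (f i) (fun u => \sum_(j <- r) f j u) (sf i) IH).
Qed.

Lemma smooth_is_derive f u v : smooth_on D f -> D u ->
  is_derive u v f (\sum_i v ord0 i * partial i f u).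
Proof.
move=> sf Du; apply: C1_is_derive.
  have : nbhs u D by exact: open_nbhs_nbhs.
  by apply: filterS => p Dp i; exact: smooth_derivable_coord.
by move=> i; apply: smooth_continuous Du; exact: smooth_partial.
Qed.

Lemma smooth_derivable f u v : smooth_on D f -> D u -> derivable f u v.
Proof. by move=> sf Du; have [] := smooth_is_derive f u v sf Du. Qed.

Lemma smooth_deriveE f u v : smooth_on D f -> D u ->
  'D_v f u = \sum_i v ord0 i * partial i f u.
Proof. by move=> sf Du; have [] := smooth_is_derive f u v sf Du. Qed.

(** The algebra of smooth functions above is real-valued; vector fields are reduced to it through
    their components. *)
Lemma smooth_rowP k (Y : 'rV[R]_m -> 'rV[R]_k) :
  smooth_on D Y <-> forall a, smooth_on D (fun u => Y u ord0 a).
Proof.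
split=> [sY a|sY].
- apply: (smooth_coind [set f | exists2 Z : 'rV[R]_m -> 'rV[R]_k, smooth_on D Z &
    f = fun u => Z u ord0 a]); last by exists Y.
  + move=> _ [Z sZ ->] u Du; split.
      exact: (@continuous_comp _ _ _ Z (fun M : 'rV[R]_k => M ord0 a : R) u
        (smooth_continuous _ _ sZ Du) (@coord_continuous _ _ _ ord0 a _)).
    by move=> i; have /derivable_rowP := smooth_derivable_coord _ _ i sZ Du.
  + move=> _ i [Z sZ ->]; exists (fun u => partial i Z u ord0 a).
      by exists (partial i Z); first exact: smooth_partial.
    move=> u Du; have dZ := smooth_derivable_coord _ _ i sZ Du.
    exact: esym (derive_row_coord _ _ Z u (coord_vec i) a dZ).
- apply: (smooth_coind [set Z : 'rV[R]_m -> 'rV[R]_k |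
    forall a, smooth_on D (fun u => Z u ord0 a)]) => //.
  + move=> Z sZ u Du.
    have dZ i : derivable Z u (coord_vec i).
      by apply/derivable_rowP => a; exact: smooth_derivable_coord (sZ a) Du.
    split => //.
    by apply: continuous_row => a; exact: smooth_continuous (sZ a) Du.
  + move=> Z i sZ; exists (fun u => \row_a partial i (fun p => Z p ord0 a) u).
      move=> a; under eq_fun do rewrite mxE.
      exact: smooth_partial.
    move=> u Du; have dZ : derivable Z u (coord_vec i).
      by apply/derivable_rowP => a; exact: smooth_derivable_coord (sZ a) Du.
    by apply/rowP => a; rewrite mxE; exact: derive_row_coord.
Qed.

Lemma smooth_derive (X : 'rV[R]_m -> 'rV[R]_m) f :
  smooth_on D X -> smooth_on D f -> smooth_on D (fun u => 'D_(X u) f u).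
Proof.
move=> /smooth_rowP sX sf.
apply: (smooth_eq_on (fun u => \sum_i X u ord0 i * partial i f u)).
  by move=> u Du; rewrite smooth_deriveE.
apply: smooth_sum => i.
exact: smoothM (sX i) (smooth_partial _ _ sf).
Qed.

Lemma smooth_row_derivable k (Y : 'rV[R]_m -> 'rV[R]_k) u v :
  smooth_on D Y -> D u -> derivable Y u v.
Proof.
move=> /smooth_rowP sY Du; apply/derivable_rowP => a.
exact: smooth_derivable.
Qed.

Lemma smooth_row_deriveE k (Y : 'rV[R]_m -> 'rV[R]_k) u v a :
  smooth_on D Y -> D u -> 'D_v Y u ord0 a = 'D_v (fun p => Y p ord0 a) u.
Proof.
by move=> sY Du; apply: derive_row_coord; exact: smooth_row_derivable.
Qed.

(** Two mean values in succession: of [g] along the [i]-th axis, then of [partial i f] along the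
    [j]-th. The left-hand side is symmetric in [i] and [j], whereas the right-hand side is not
    visibly so. *)
Lemma second_difference f (u : 'rV[R]_m) i j (h : R) :
  0 <= h -> smooth_on D f ->
  (forall s t : R, 0 <= s <= 1 -> 0 <= t <= 1 ->
    D (u + (s * h) *: coord_vec i + (t * h) *: coord_vec j)) ->
  exists s t : R, [/\ 0 <= s <= 1, 0 <= t <= 1 &
   f (u + h *: coord_vec i + h *: coord_vec j) - f (u + h *: coord_vec i)
     - (f (u + h *: coord_vec j) - f u) =
   h * (h * partial j (partial i f) (u + (s * h) *: coord_vec i + (t * h) *: coord_vec j))].
Proof.
move=> h0 sf box.
pose g p := f (p + h *: coord_vec j) - f p.
have dshift (p w v : 'rV[R]_m) : derivable f (p + w) v ->
    is_derive p v (fun p => f (p + w)) ('D_v f (p + w)).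
  have E : (fun k : R => k^-1 *: (((fun p => f (p + w)) \o shift p) (k *: v) - f (p + w)))
      = (fun k : R => k^-1 *: ((f \o shift (p + w)) (k *: v) - f (p + w))).
    by apply/funext => k /=; rewrite addrA.
  by move=> df; split; rewrite /derivable /derive E.
have in01 : 0 <= (1 : R) <= 1 by rewrite ler01 lexx.
have in00 : 0 <= (0 : R) <= 1 by rewrite ler01 lexx.
have dg (s : R) : 0 <= s <= 1 -> is_derive (u + (s * h) *: coord_vec i) (coord_vec i) g
    (partial i f (u + (s * h) *: coord_vec i + h *: coord_vec j)
      - partial i f (u + (s * h) *: coord_vec i)).
  move=> s01; apply: is_deriveB.
    apply: dshift; apply: smooth_derivable_coord => //.
    by have := box s 1 s01 in01; rewrite mul1r.
  apply/derivableP/smooth_derivable_coord => //.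
  by have := box s 0 s01 in00; rewrite mul0r scale0r addr0.
have [s s01] := @MVT_line _ g u (coord_vec i) h (fun s s01 => @ex_derive _ _ _ _ _ _ _ (dg s s01)).
rewrite (@derive_val _ _ _ _ _ _ _ (dg s s01)).
set p := u + (s * h) *: coord_vec i => Eg.
have dpf (t : R) : 0 <= t <= 1 -> derivable (partial i f) (p + (t * h) *: coord_vec j) (coord_vec j).
  move=> t01; apply: smooth_derivable_coord; first exact: smooth_partial.
  exact: box.
have [t t01 Et] := @MVT_line _ (partial i f) p (coord_vec j) h dpf.
exists s, t; split => //.
by move: Eg; rewrite Et.
Qed.

(** Both mixed partials are limits of the same second difference: they take a common value at two
    points arbitrarily close to [u], and continuity brings both points to [u]. *)
Lemma partialC f i j u : smooth_on D f -> D u ->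
  partial i (partial j f) u = partial j (partial i f) u.
Proof.
move=> sf Du; apply/eqP; rewrite -subr_eq0 -normr_le0; apply/ler_addgt0Pl => e e0.
rewrite addr0.
have e20 : 0 < e / 2 by rewrite divr_gt0.
have tri (X Y Z : R) : `|X - Z| <= e / 2 -> `|Z - Y| <= e / 2 -> `|X - Y| <= e.
  by move=> H1 H2; rewrite [e]splitr (le_trans (ler_distD Z _ _))// lerD.
have cont a b : {for u, continuous (partial a (partial b f))}.
  by apply: smooth_continuous Du; do 2 apply: smooth_partial.
have c1 : \forall p \near u, `|partial i (partial j f) u - partial i (partial j f) p| <= e / 2.
  by have /cvgrPdist_le := cont i j; apply.
have c2 : \forall p \near u, `|partial j (partial i f) p - partial j (partial i f) u| <= e / 2.
  by have /cvgrPdistC_le := cont j i; apply.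
have cD : \forall p \near u, D p by exact: open_nbhs_nbhs.
have : nbhs u (D `&`
    ((fun p => `|partial i (partial j f) u - partial i (partial j f) p| <= e / 2) `&`
     (fun p => `|partial j (partial i f) p - partial j (partial i f) u| <= e / 2))).
  exact: filterI cD (filterI c1 c2).
move=> /nbhs_ballP[d /= d0 dP].
(* Two successive displacements of norm at most [d / 3] stay in the ball of radius [d]. *)
pose h := d / 3.
have h0 : 0 < h by rewrite divr_gt0.
have inb a b (s t : R) : 0 <= s <= 1 -> 0 <= t <= 1 ->
    ball u d (u + (s * h) *: coord_vec a + (t * h) *: coord_vec b).
  have bd (r : R) c : 0 <= r <= 1 -> `|(r * h) *: coord_vec c : 'rV[R]_m| <= h.
    move=> /andP[r0 r1]; have hge0 := ltW h0.
    have rh0 : 0 <= r * h by exact: mulr_ge0.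
    have rh1 : r * h <= h by exact: ler_piMl.
    rewrite normrZ ger0_norm//; apply: le_trans rh1.
    by apply: ler_piMr => //; exact: norm_coord_vec_le1.
  move=> s01 t01; rewrite -ball_normE /= opprD (opprD u) !addrA subrr sub0r.
  rewrite -opprD normrN (le_lt_trans (ler_normD _ _))//.
  rewrite (le_lt_trans (lerD (bd _ _ s01) (bd _ _ t01)))// /h.
  by lra.
have [s [t [s01 t01 E1]]] := second_difference f u i j h (ltW h0) sf
  (fun s t s01 t01 => (dP _ (inb i j s t s01 t01)).1).
have [s' [t' [s01' t01' E2]]] := second_difference f u j i h (ltW h0) sf
  (fun s t s01 t01 => (dP _ (inb j i s t s01 t01)).1).
(* Each side is the second difference divided by the square of [h]. *)
have E : partial j (partial i f) (u + (s * h) *: coord_vec i + (t * h) *: coord_vec j) =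
    partial i (partial j f) (u + (s' * h) *: coord_vec j + (t' * h) *: coord_vec i).
  move: E1 E2; rewrite [u + h *: coord_vec j + h *: coord_vec i]addrAC.
  have hn0 : h != 0 by rewrite gt_eqF.
  move: (partial j _ _) (partial i _ _) (f _) (f _) (f _) (f _) => X Y a b c k E1 E2.
  by apply: (mulfI hn0); apply: (mulfI hn0); rewrite -E1 -E2; ring.
have [_ [_ H1]] := dP _ (inb i j s t s01 t01).
have [_ [H2 _]] := dP _ (inb j i s' t' s01' t01').
rewrite -E in H2.
exact: tri H2 H1.
Qed.

End Smooth.

End Calculus.

(** * Local structure of level sets *)

Section LevelSets.
Context {R : realType} {m : nat}.
Implicit Types (U D W : set 'rV[R]_m) (phi F : 'rV[R]_m -> R) (p q z w v : 'rV[R]_m).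

Lemma smooth_subset D U (V : normedModType R) (f : 'rV[R]_m -> V) :
  U `<=` D -> smooth_on D f -> smooth_on U f.
Proof. by move=> UD sf s u /UD; exact: sf. Qed.

(** A 1-Lipschitz retraction of the line onto [0, 1]. It extends paths to all real times, so that
    vanishing of a derivative on the whole line can be used without treating endpoints. *)
Definition clamp (t : R) : R := Num.max 0 (Num.min 1 t).

Lemma clamp01 t : 0 <= clamp t <= 1.
Proof. by rewrite /clamp le_max lexx/= ge_max ler01 ge_min lexx. Qed.

Lemma clamp_id t : 0 <= t <= 1 -> clamp t = t.
Proof. by move=> /andP[t0 t1]; rewrite /clamp min_r// max_r. Qed.

Lemma clamp_lip s t : `|clamp s - clamp t| <= `|s - t|.
Proof.
have := ler_norm (s - t); have := ler_norm (t - s); rewrite distrC.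
move: `|s - t| => d ts st; rewrite ler_norml /clamp /Num.max /Num.min.
by do ![case: ifPn]; rewrite -?leNgt => *; apply/andP; split; lra.
Qed.

Lemma coord_vec_id (a : 'I_m) : (coord_vec a : 'rV[R]_m) ord0 a = 1.
Proof. by rewrite /coord_vec mxE !eqxx. Qed.

Lemma sum_coord_vec (a : 'I_m) (f : 'I_m -> R) :
  \sum_i (coord_vec a : 'rV[R]_m) ord0 i * f i = f a.
Proof.
rewrite (bigD1 a)//= coord_vec_id mul1r big1 ?addr0// => i ia.
by rewrite /coord_vec mxE eqxx/= (negbTE ia) mul0r.
Qed.

Lemma ball_segment p q q' (r s : R) : `|q - p| < r -> `|q' - p| < r -> 0 <= s <= 1 ->
  `|q + s *: (q' - q) - p| < r.
Proof.
move=> qr qr' /andP[s0 s1].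
have -> : q + s *: (q' - q) - p = (1 - s) *: (q - p) + s *: (q' - p).
  by apply/rowP => i; rewrite !mxE; ring.
rewrite (le_lt_trans (ler_normD _ _))// !normrZ (ger0_norm s0) ger0_norm ?subr_ge0//.
move: (`|q - p|) (`|q' - p|) qr qr' => x y xr yr.
have H1 : (1 - s) * x <= (1 - s) * r by rewrite ler_wpM2l ?subr_ge0// ltW.
(* At [s = 0] the strict inequality must come from the first term, elsewhere from the second. *)
have [->|sn0] := eqVneq s 0; first by rewrite subr0 mul1r mul0r addr0.
have H2 : s * y < s * r by rewrite ltr_pM2l// lt_def sn0.
by lra.
Qed.

(* [phi] has [a]-th partial derivative at least [k] on the ball of centre [p]
   and radius [r]; [ht] is the [a]-th coordinate centred at [p] and [pr] the
   projection along it on the hyperplane through [p]. *)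
Section Chart.
Context (U : set 'rV[R]_m) (phi : 'rV[R]_m -> R) (p : 'rV[R]_m) (a : 'I_m) (r k S : R).
Hypotheses (r0 : 0 < r) (k0 : 0 < k) (sphi : smooth_on U phi)
  (inU : forall q, `|q - p| < r -> U q)
  (dak : forall q, `|q - p| < r -> k <= partial a phi q)
  (dS : forall q, `|q - p| < r -> \sum_i `|partial i phi q| <= S).

Let ht q : R := q ord0 a - p ord0 a.
Let pr q := q - ht q *: coord_vec a.

Let prE q : q = pr q + ht q *: coord_vec a.
Proof. by rewrite /pr subrK. Qed.

Let htD q s : ht (q + s *: coord_vec a) = ht q + s.
Proof. by rewrite /ht 2!mxE coord_vec_id mulr1 addrAC. Qed.

Let ht_pr q : ht (pr q) = 0.
Proof. by rewrite /pr -scaleNr htD subrr. Qed.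

Let pr_ht0 q s : ht q = 0 -> pr (q + s *: coord_vec a) = q.
Proof. by move=> q0; rewrite /pr htD q0 add0r addrK. Qed.

(* Mean value theorem on the segment [q, q'], at whose ends [phi] vanishes. *)
Lemma zero_set_lip q q' : `|q - p| < r -> `|q' - p| < r -> phi q = 0 -> phi q' = 0 ->
  k * `|ht q' - ht q| <= S * `|pr q' - pr q|.
Proof.
move=> qr qr' q0 q0'.
have seg (s : R) : 0 <= s <= 1 -> `|q + (s * 1) *: (q' - q) - p| < r.
  by move=> s01; rewrite mulr1; exact: ball_segment.
have oB : open (ball p r) by exact: ball_open.
have Bin q1 : ball p r q1 -> `|q1 - p| < r by rewrite -ball_normE /= distrC.
have sB : smooth_on (ball p r) phi.
  by apply: smooth_subset sphi => q1 /Bin; exact: inU.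
have inB q1 : `|q1 - p| < r -> ball p r q1 by rewrite -ball_normE /= distrC.
have [s s01] := @MVT_line _ _ phi q (q' - q) 1
  (fun s s01 => smooth_derivable _ oB _ _ _ sB (inB _ (seg s s01))).
rewrite scale1r [q + (_ - _)]addrC subrK q0 q0' subr0 mul1r.
rewrite (smooth_deriveE _ oB _ _ _ sB (inB _ (seg s s01))).
set x := q + _ => E.
have xr : `|x - p| < r := seg s s01.
(* The vanishing derivative along [q' - q] is split into its vertical part, bounded below through
   [k], and its horizontal part, bounded above through [S]. *)
have {}E : (ht q' - ht q) * partial a phi x =
    - \sum_i (pr q' - pr q) ord0 i * partial i phi x.
  apply/eqP; rewrite -addr_eq0 eq_sym {1}E; apply/eqP.
  rewrite -(sum_coord_vec a (fun i => partial i phi x)) mulr_sumr -big_split/=.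
  apply: eq_bigr => i _; rewrite mulrA -mulrDl; congr (_ * _).
  by rewrite /pr !mxE; ring.
have := congr1 Num.norm E; rewrite normrM normrN => {}E.
have ->: k * `|ht q' - ht q| = `|ht q' - ht q| * k by rewrite mulrC.
apply: (@le_trans _ _ (`|ht q' - ht q| * `|partial a phi x|)).
  by rewrite ler_wpM2l// (le_trans (dak _ xr))// ler_norm.
rewrite E (le_trans (ler_norm_sum _ _ _))//.
apply: (@le_trans _ _ (\sum_i `|partial i phi x| * `|pr q' - pr q|)).
  apply: ler_sum => i _; rewrite normrM mulrC ler_wpM2l//.
  exact: norm_coord_le.
by rewrite -mulr_suml ler_wpM2r// dS.
Qed.

Context (rho delta : R).
Hypotheses (rho0 : 0 < rho) (rhodelta : rho + delta <= r)
  (top_gt0 : forall y : 'rV[R]_m, `|y - p| < delta -> 0 < phi (y + rho *: coord_vec a))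
  (bot_lt0 : forall y : 'rV[R]_m, `|y - p| < delta -> phi (y - rho *: coord_vec a) < 0).

(** A cylinder with axis along the [a]-th coordinate. [phi] is positive on its top and negative on
    its bottom, so every vertical segment meets the zero set; [rho + delta <= r] keeps the cylinder
    in the ball where the bounds on the partials hold. *)
Definition chart_box : set 'rV[R]_m := [set q | `|ht q| < rho /\ `|pr q - p| < delta].

Let box_ball y s : `|y - p| < delta -> `|s| <= rho -> `|y + s *: coord_vec a - p| < r.
Proof.
move=> yd sr; rewrite addrAC (le_lt_trans (ler_normD _ _))//.
apply: lt_le_trans rhodelta; rewrite [rho + _]addrC; apply: ltr_leD => //.
by rewrite normrZ (le_trans _ sr)// ler_piMr ?norm_coord_vec_le1.
Qed.

Lemma chart_box_sub q : chart_box q -> `|q - p| < r.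
Proof. by move=> [/ltW hq prq]; rewrite (prE q); exact: box_ball. Qed.

Lemma open_chart_box : open chart_box.
Proof.
have -> : chart_box = ((fun q => `|ht q|) @^-1` [set t | t < rho]) `&`
   ((fun q => `|pr q - p|) @^-1` [set t | t < delta]) by [].
have cht : continuous ht.
  move=> q.
  exact: (@continuousB R R _ (fun q => q ord0 a) (cst (p ord0 a)) q
    (@coord_continuous R _ _ ord0 a q) (@cst_continuous _ _ _ q)).
have cpr : continuous pr.
  move=> q; apply: (@continuousB R _ _ id (fun q => ht q *: coord_vec a) q).
    exact: cvg_id.
  exact: (@cvgZr_tmp R _ _ (nbhs q) _ ht (ht q) _ (cht q)).
apply: openI; (apply: open_comp; last exact: open_lt) => q _.
- exact: (@cvg_norm _ _ _ (nbhs q) _ ht (ht q) (cht q)).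
- apply: (@cvg_norm _ _ _ (nbhs q) _ (fun q => pr q - p) (pr q - p)).
  exact: (@continuousB R _ _ pr (cst p) q (cpr q) (@cst_continuous _ _ _ q)).
Qed.

(** Intermediate value theorem on a vertical segment. The zero is strictly inside because [phi] has
    a strict sign at both ends. *)
Lemma chart_height y : `|y - p| < delta ->
  exists2 s, `|s| < rho & phi (y + s *: coord_vec a) = 0.
Proof.
move=> yd.
have oB : open (ball p r) by exact: ball_open.
have Bin q1 : ball p r q1 -> `|q1 - p| < r by rewrite -ball_normE /= distrC.
have sB : smooth_on (ball p r) phi.
  by apply: smooth_subset sphi => q1 /Bin; exact: inU.
have inB q1 : `|q1 - p| < r -> ball p r q1 by rewrite -ball_normE /= distrC.
have cont : {within `[- rho, rho], continuous (fun s => phi (s *: coord_vec a + y))}.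
  apply: derivable_within_continuous => s; rewrite in_itv /= => srho.
  have ds : derivable phi (s *: coord_vec a + y) (coord_vec a).
    apply: (smooth_derivable _ oB _ _ _ sB); apply: inB.
    by rewrite [_ + y]addrC; apply: box_ball; rewrite ?ler_norml.
  by have [] := is_derive_line _ _ _ _ _ _ ds.
have bot := bot_lt0 _ yd; have top := top_gt0 _ yd.
have le_rho : - rho <= rho by rewrite -subr_ge0 opprK addr_ge0 ?ltW.
have [|s] := @IVT R _ (- rho) rho 0 le_rho cont.
  by rewrite scaleNr ![_ + y]addrC ge_min le_max (ltW bot) (ltW top) orbT.
rewrite in_itv /= [_ + y]addrC => /andP[s1 s2] E; exists s => //.
rewrite ltr_norml !lt_def s1 s2 !andbT; apply/andP; split; apply/eqP => sE.
- by move: bot; rewrite -scaleNr -sE E ltxx.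
- by move: top; rewrite sE E ltxx.
Qed.

(** The straight segment between the projections of [z] and [w] is lifted to the zero set. By
    [zero_set_lip] the zero set is a Lipschitz graph over the hyperplane, so the lift is
    Lipschitz. *)
Lemma chart_path z w : chart_box z -> chart_box w -> phi z = 0 -> phi w = 0 ->
  exists (c : R -> 'rV[R]_m) (K : R),
    [/\ c 0 = z, c 1 = w, forall t, chart_box (c t) /\ phi (c t) = 0
      & forall s t, `|c s - c t| <= K * `|s - t|].
Proof.
move=> Wz Ww z0 w0.
pose y t := pr z + clamp t *: (pr w - pr z).
have hy t : ht (y t) = 0.
  have -> : ht (y t) = (1 - clamp t) * ht (pr z) + clamp t * ht (pr w).
    by rewrite /ht /y !mxE; ring.
  by rewrite !ht_pr !mulr0 addr0.
have yd t : `|y t - p| < delta.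
  by apply: ball_segment (clamp01 t); [exact: Wz.2|exact: Ww.2].
(* The heights are chosen pointwise with no regularity; the Lipschitz bound is recovered afterwards
   from [lip]. *)
have /choice[s sP] : forall t, exists s, `|s| < rho /\ phi (y t + s *: coord_vec a) = 0.
  by move=> t; have [s ? ?] := chart_height _ (yd t); exists s.
pose c t := y t + s t *: coord_vec a.
have prc t : pr (c t) = y t by exact: pr_ht0.
have htc t : ht (c t) = s t by rewrite /c htD hy add0r.
have Wc t : chart_box (c t) by split; rewrite ?htc ?prc; [exact: (sP t).1|].
have cc t := chart_box_sub _ (Wc t).
have lip q q' : chart_box q -> chart_box q' -> phi q = 0 -> phi q' = 0 ->
    `|q' - q| <= (1 + k^-1 * S) * `|pr q' - pr q|.
  move=> Wq Wq' q0 q0'.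
  have H := zero_set_lip _ _ (chart_box_sub _ Wq) (chart_box_sub _ Wq') q0 q0'.
  have -> : q' - q = (pr q' - pr q) + (ht q' - ht q) *: coord_vec a.
    by apply/rowP => i; rewrite /pr !mxE; ring.
  rewrite (le_trans (ler_normD _ _))// mulrDl mul1r lerD// normrZ.
  apply: (@le_trans _ _ `|ht q' - ht q|); first by rewrite ler_piMr ?norm_coord_vec_le1.
  by rewrite -mulrA ler_pdivlMl.
(* Uniqueness of the height over a given projection: it forces the lift to start at [z] and end at
   [w]. *)
have lip0 q q' : chart_box q -> chart_box q' -> phi q = 0 -> phi q' = 0 ->
    pr q' = pr q -> q' = q.
  move=> Wq Wq' q0 q0' E; apply/eqP; rewrite -subr_eq0 -normr_le0.
  by rewrite (le_trans (lip _ _ Wq Wq' q0 q0'))// E subrr normr0 mulr0.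
exists c, ((1 + k^-1 * S) * `|pr w - pr z|); split.
- apply: lip0 => //; first exact: (sP 0).2.
  by rewrite prc /y clamp_id ?lexx ?ler01// scale0r addr0.
- apply: lip0 => //; first exact: (sP 1).2.
  by rewrite prc /y clamp_id ?lexx ?ler01// scale1r addrC subrK.
- by move=> t; split; [exact: Wc|exact: (sP t).2].
- move=> t1 t2; rewrite (le_trans (lip _ _ (Wc t2) (Wc t1) (sP t2).2 (sP t1).2))//.
  rewrite !prc -!mulrA; apply: ler_wpM2l.
    have S0 : 0 <= S.
      apply: le_trans (dS p _); first by apply: sumr_ge0 => i _.
      by rewrite subrr normr0.
    by rewrite addr_ge0 ?mulr_ge0 ?invr_ge0 ?(ltW k0).
  have -> : y t1 - y t2 = (clamp t1 - clamp t2) *: (pr w - pr z).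
    by apply/rowP => i; rewrite /y !mxE; ring.
  by rewrite normrZ mulrC ler_wpM2l// clamp_lip.
Qed.

End Chart.

End LevelSets.

(** For any property [P] of values, [near_set P] is open in the ambient space and its trace on [L]
    is the set where [f] satisfies [P]. Applied to being equal to [f p] and to its negation, this
    makes the fibre through [p] both open and closed in [L]. *)
Lemma connected_locally_cst (T : topologicalType) (X : Type) (L : set T) (f : T -> X) :
  connected L ->
  (forall p : T, L p -> exists W : set T, [/\ open W, W p & forall w : T, L w -> W w -> f w = f p]) ->
  forall p q : T, L p -> L q -> f q = f p.
Proof.
move=> cL locc p q Lp Lq.
pose near_set (P : X -> Prop) : set T :=
  [set w | exists W : set T, [/\ open W, W w & forall v : T, L v -> W v -> P (f v)]].
have open_near P : open (near_set P).
  rewrite openE => w [W [oW Ww H]]; rewrite /interior.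
  by apply: filterS (open_nbhs_nbhs (conj oW Ww)) => w' Ww'; exists W.
have in_near P w : L w -> P (f w) -> near_set P w.
  move=> Lw Pw; have [W [oW Ww H]] := locc w Lw; exists W; split => // v Lv Wv.
  by rewrite H.
have near_in P w : L w -> near_set P w -> P (f w) by move=> Lw [W [_ Ww]]; apply.
suff E : L `&` [set w | f w = f p] = L.
  by have [] : (L `&` [set w | f w = f p]) q by rewrite E.
apply: cL.
- by exists p.
- exists (near_set (fun y => y = f p)); first exact: open_near.
  by apply/seteqP; split => w [Lw Hw]; split => //; [exact: in_near|exact: near_in Hw].
- exists (~` near_set (fun y => y <> f p)).
    by rewrite closedC; exact: open_near.
  apply/seteqP; split => w [Lw Hw]; split => //=.
    by move=> /(near_in (fun y => y <> f p)); exact.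
  by apply: contrapT => ne; apply: Hw; exact: in_near.
Qed.

(** * Integral manifolds and leaves of the kernel of a differential *)

Section Leaves.
Context {R : realType} {m : nat}.
Implicit Types (U D W L : set 'rV[R]_m) (phi F : 'rV[R]_m -> R) (p q z w v : 'rV[R]_m).

(** Some partial derivative of [phi] is nonzero at [p]; continuity supplies the bounds required by
    the chart around [p], and the chart box is the desired neighbourhood. *)
Lemma submersion_chart U phi p : open U -> smooth_on U phi -> U p -> phi p = 0 ->
  (exists v, 'D_v phi p != 0) ->
  exists W, [/\ open W, W p, W `<=` U & forall z w, W z -> W w -> phi z = 0 -> phi w = 0 ->
    exists (c : R -> 'rV[R]_m) (K : R),
    [/\ c 0 = z, c 1 = w, forall t, W (c t) /\ phi (c t) = 0
      & forall s t, `|c s - c t| <= K * `|s - t|]].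
Proof.
move=> oU sphi Up p0 [v dv].
have [a da0] : exists a, partial a phi p != 0.
  apply: contrapT => H; move: dv; rewrite (smooth_deriveE _ oU _ _ _ sphi Up).
  rewrite big1 ?eqxx// => i _; have [->|di] := eqVneq (partial i phi p) 0.
    by rewrite mulr0.
  by exfalso; apply: H; exists i.
(* Replacing [phi] by its opposite changes neither the zero set nor the paths in it. *)
wlog da : phi sphi p0 {dv} da0 / 0 < partial a phi p.
  move=> H; have [da|da] := ltP 0 (partial a phi p); first exact: (H phi).
  have sphi' := smoothN U oU phi sphi.
  have dE : partial a (fun u => - phi u) p = - partial a phi p.
    exact: deriveN (smooth_derivable _ oU _ p (coord_vec a) sphi Up).
  have [||||W [oW Wp WU cW]] := H (fun u => - phi u).
  - exact: sphi'.
  - by rewrite p0 oppr0.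
  - by rewrite dE oppr_eq0.
  - by rewrite dE oppr_gt0 lt_neqAle da0.
  exists W; split => // z w Wz Ww z0 w0.
  have [||c [K [c0 c1 cc cl]]] := cW z w Wz Ww; rewrite ?z0 ?w0 ?oppr0//.
  exists c, K; split => // t; have [Wt ct0] := cc t; split => //.
  by rewrite -[phi _]opprK ct0 oppr0.
(* Half the value at [p] is a lower bound that persists nearby; the 1 added in [S] plays the same
   part for the upper bounds. *)
pose k := partial a phi p / 2.
have k0 : 0 < k by rewrite divr_gt0.
pose S := \sum_i (`|partial i phi p| + 1).
have cpart i : {for p, continuous (partial i phi)}.
  by apply: smooth_continuous Up; exact: smooth_partial.
have n1 : nbhs p [set q | k < partial a phi q].
  have /cvgr_gt := cpart a; apply.
  by rewrite /k ltr_pdivrMr// mulr_natr mulr2n ltrDr.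
have n2 : nbhs p [set q | forall i, `|partial i phi q| <= `|partial i phi p| + 1].
  apply: (@filter_forall _ _ (fun i q => `|partial i phi q| <= `|partial i phi p| + 1) (nbhs p) _) => i.
  have /cvgrPdistC_le := cpart i => /(_ 1 ltr01); apply: filterS => q H.
  by rewrite -lerBlDl (le_trans (lerB_dist _ _)).
have : nbhs p (U `&` ([set q | k < partial a phi q] `&`
    [set q | forall i, `|partial i phi q| <= `|partial i phi p| + 1])).
  exact: filterI (open_nbhs_nbhs (conj oU Up)) (filterI n1 n2).
move=> /nbhs_ballP[r /= r0 rP].
have {}rP q : `|q - p| < r -> [/\ U q, k <= partial a phi q
    & forall i, `|partial i phi q| <= `|partial i phi p| + 1].
  move=> qr; have : ball p r q by rewrite -ball_normE /= distrC.
  by move=> /rP [? [/ltW ? ?]].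
have dS q : `|q - p| < r -> \sum_i `|partial i phi q| <= S.
  by move=> /rP [_ _ H]; apply: ler_sum => i _; exact: H.
(* Half the radius is kept in reserve for [delta]. The signs at the top and bottom of the axis come
   from the mean value theorem, as [phi] vanishes at [p] and increases along the axis. *)
pose rho := r / 2.
have rho0 : 0 < rho by rewrite divr_gt0.
have inr (t : R) : `|t| <= rho -> `|p + t *: coord_vec a - p| < r.
  move=> tr; rewrite addrC addKr normrZ (@le_lt_trans _ _ rho)//.
    by rewrite (le_trans _ tr)// ler_piMr ?norm_coord_vec_le1.
  by rewrite /rho ltr_pdivrMr// mulr_natr mulr2n ltrDr.
have mvt (h : R) : `|h| <= rho -> exists2 q, `|q - p| < r &
    phi (p + h *: coord_vec a) = h * partial a phi q.
  move=> hr.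
  have seg (s : R) : 0 <= s <= 1 -> `|p + (s * h) *: coord_vec a - p| < r.
    move=> /andP[s0 s1]; apply: inr; rewrite normrM ger0_norm// (le_trans _ hr)//.
    exact: ler_piMl.
  have [s s01] := @MVT_line _ _ phi p (coord_vec a) h (fun s s01 =>
    smooth_derivable _ oU _ _ _ sphi (let: And3 H _ _ := rP _ (seg s s01) in H)).
  rewrite p0 subr0 => E; exists (p + (s * h) *: coord_vec a) => //.
  exact: seg.
have top : 0 < phi (p + rho *: coord_vec a).
  have [|q /rP[_ kq _] ->] := mvt rho; first by rewrite ger0_norm ?(ltW rho0).
  by rewrite mulr_gt0// (lt_le_trans k0).
have bot : phi (p - rho *: coord_vec a) < 0.
  have [|q /rP[_ kq _]] := mvt (- rho); first by rewrite normrN ger0_norm ?(ltW rho0).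
  by rewrite scaleNr => ->; rewrite mulNr oppr_lt0 mulr_gt0// (lt_le_trans k0).
have ctop : {for p + rho *: coord_vec a, continuous phi}.
  apply: smooth_continuous sphi _; have [] // := rP (p + rho *: coord_vec a).
  by apply: inr; rewrite ger0_norm ?(ltW rho0).
have cbot : {for p - rho *: coord_vec a, continuous phi}.
  apply: smooth_continuous sphi _; have [] // := rP (p - rho *: coord_vec a).
  by rewrite -scaleNr; apply: inr; rewrite normrN ger0_norm ?(ltW rho0).
have /nbhs_ballP[d1 /= d10 d1P] : nbhs (p + rho *: coord_vec a) [set q | 0 < phi q].
  by have /cvgr_gt := ctop; apply.
have /nbhs_ballP[d2 /= d20 d2P] : nbhs (p - rho *: coord_vec a) [set q | phi q < 0].
  by have /cvgr_lt := cbot; apply.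
(* The bound by [rho] keeps the box in the ball; [d1] and [d2] preserve the signs on the top and
   bottom faces. *)
pose delta := Num.min rho (Num.min d1 d2).
have delta0 : 0 < delta by rewrite !lt_min rho0 d10 d20.
have rd : rho + delta <= r.
  by rewrite [leRHS]splitr lerD2l ge_min lexx.
have shiftE q e : `|q - p| = `|p + e - (q + e)|.
  by rewrite opprD addrACA subrr addr0 distrC.
have topd y : `|y - p| < delta -> 0 < phi (y + rho *: coord_vec a).
  move=> yd; apply: d1P; rewrite -ball_normE /= -shiftE (lt_le_trans yd)//.
  by rewrite !ge_min lexx orbT.
have botd y : `|y - p| < delta -> phi (y - rho *: coord_vec a) < 0.
  move=> yd; apply: d2P; rewrite -ball_normE /= -shiftE (lt_le_trans yd)//.
  by rewrite !ge_min lexx !orbT.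
have inU q : `|q - p| < r -> U q by move=> /rP[].
have dak q : `|q - p| < r -> k <= partial a phi q by move=> /rP[].
exists (chart_box p a rho delta); split.
- exact: open_chart_box.
- by split; rewrite ?subrr ?normr0// scale0r subr0 subrr normr0.
- by move=> q Wq; apply: inU; exact: (chart_box_sub _ _ _ _ _ rd _ Wq).
- move=> z w Wz Ww z0 w0.
  exact: (chart_path U phi p a r k S r0 k0 sphi inU dak dS rho delta rho0 rd topd botd).
Qed.

Lemma smooth_deriveZD D F q (k : R) v w : open D -> smooth_on D F -> D q ->
  'D_(k *: v + w) F q = k * 'D_v F q + 'D_w F q.
Proof.
move=> oD sF Dq; rewrite !(smooth_deriveE _ oD _ _ _ sF Dq) mulr_sumr -big_split/=.
by apply: eq_bigr => i _; rewrite !mxE mulrDl mulrA.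
Qed.

Lemma smooth_expansion D F q : open D -> smooth_on D F -> D q ->
  forall e, 0 < e -> \forall h \near (0 : 'rV[R]_m),
    `|F (q + h) - F q - 'D_h F q| <= e * `|h|.
Proof.
move=> oD sF Dq e e0.
have c1 : \forall p \near q, forall i, derivable F p (coord_vec i).
  have : nbhs q D by exact: open_nbhs_nbhs.
  by apply: filterS => p Dp i; exact: (smooth_derivable_coord _ _ _ i sF Dp).
have c2 i : {for q, continuous (partial i F)}.
  by apply: smooth_continuous Dq; exact: smooth_partial.
have := C1_expansion _ _ _ c1 c2 _ e0; apply: filterS => h.
by rewrite (smooth_deriveE _ oD _ _ _ sF Dq).
Qed.

(* If [ker (d phi) <= ker (d F)] along a Lipschitz curve in a level set of
   [phi], then [d F] is a multiple of [d phi] and [F] is stationary on the curve. *)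
Lemma is_derive_curve0 D F phi (c : R -> 'rV[R]_m) (K x : R) :
  open D -> smooth_on D F -> smooth_on D phi -> D (c x) ->
  (forall t, phi (c t) = 0) -> (forall s t, `|c s - c t| <= K * `|s - t|) ->
  (exists v, 'D_v phi (c x) != 0) ->
  (forall v, 'D_v phi (c x) = 0 -> 'D_v F (c x) = 0) ->
  is_derive x 1 (fun t => F (c t)) 0.
Proof.
move=> oD sF sphi Dq c0 clip [v0 v0n] ker.
set q := c x in Dq v0n ker *.
pose l := 'D_v0 F q / 'D_v0 phi q.
have dFE v : 'D_v F q = l * 'D_v phi q.
  (* This combination of [v0] and [v] is the projection of [v] to the kernel of d phi along [v0], so
     d F kills it. *)
  have := ker (- ('D_v phi q / 'D_v0 phi q) *: v0 + v).
  rewrite !(smooth_deriveZD D) // => H.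
  have E1 : - ('D_v phi q / 'D_v0 phi q) * 'D_v0 phi q + 'D_v phi q = 0.
    by rewrite mulNr divfK// addNr.
  have := H E1; rewrite /l; move: ('D_v phi q) ('D_v0 phi q) ('D_v0 F q) ('D_v F q) => a b f0 f.
  move=> /eqP; rewrite addrC addr_eq0 => /eqP ->.
  by rewrite mulNr opprK mulrC mulrA mulrAC.
(* The factor [1 + |l|] collects the expansion error of [F] and [|l|] times that of [phi]; [|K| + 1]
   is a positive Lipschitz constant turning increments of [c] into increments of time. *)
pose M := (1 + `|l|) * (`|K| + 1).
have M0 : 0 < M by rewrite mulr_gt0// ?ltr_wpDr// ltr_wpDl.
have clip' s t : `|c s - c t| <= (`|K| + 1) * `|s - t|.
  rewrite (le_trans (clip s t))// ler_wpM2r// (le_trans (ler_norm K))//.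
  by rewrite lerDl.
suff : (fun h => h^-1 *: ((F \o c \o shift x) (h *: 1) - F (c x))) @ 0^' --> (0 : R).
  by move=> H; split; [apply/cvg_ex; exists 0|exact: cvg_lim].
apply/cvgrPdistC_le => e e0.
have e'0 : 0 < e / M by rewrite divr_gt0.
have : nbhs (0 : 'rV[R]_m) ((fun h => `|F (q + h) - F q - 'D_h F q| <= e / M * `|h|) `&`
    (fun h => `|phi (q + h) - phi q - 'D_h phi q| <= e / M * `|h|)).
  exact: filterI (smooth_expansion D F q oD sF Dq _ e'0)
    (smooth_expansion D phi q oD sphi Dq _ e'0).
move=> /nbhs_ballP[d /= d0 dP].
have K0 : 0 < `|K| + 1 by rewrite ltr_wpDl.
near=> h.
have h0 : h != 0 by near: h; exact: nbhs_dnbhs_neq.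
have hd : `|h| < d / (`|K| + 1) by near: h; apply: dnbhs0_lt; rewrite divr_gt0.
pose k := c (h + x) - q.
have kh : `|k| <= (`|K| + 1) * `|h|.
  by have := clip' (h + x) x; rewrite addrK.
have kd : ball (0 : 'rV[R]_m) d k.
  rewrite -ball_normE /= sub0r normrN (le_lt_trans kh)//.
  by rewrite mulrC -ltr_pdivlMr.
have [] := dP k kd.
have -> : q + k = c (h + x) by rewrite /k addrC subrK.
(* As [phi] vanishes along [c], its expansion becomes a bound on ['D_k phi q] itself. *)
rewrite c0 (c0 x) subrr sub0r normrN dFE => HF Hphi.
rewrite [h *: 1]mulr1 subr0 /= -/q normrM normfV ler_pdivrMl ?normr_gt0//.
have eK : e / M * `|k| * (1 + `|l|) <= `|h| * e.
  have -> : `|h| * e = e / M * ((`|K| + 1) * `|h|) * (1 + `|l|).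
    by rewrite /M; field; rewrite gt_eqF// gt_eqF// ltr_wpDr.
  by rewrite ler_wpM2r ?addr_ge0// ler_wpM2l ?(ltW e'0).
rewrite (le_trans _ eK)//.
have : `|l * 'D_k phi q| <= `|l| * (e / M * `|k|) by rewrite normrM ler_wpM2l.
move: ('D_k phi q) (F _) (F _) HF => z b a HF Hl.
have -> : a - b = (a - b - l * z) + l * z by rewrite subrK.
rewrite (le_trans (ler_normD _ _))// mulrDr mulr1 lerD// mulrC.
by rewrite mulrC [_ * `|l|]mulrC.
Unshelve. all: by end_near. Qed.

Lemma lipschitz_continuous (c : R -> 'rV[R]_m) (K t : R) :
  (forall s t, `|c s - c t| <= K * `|s - t|) -> {for t, continuous c}.
Proof.
move=> cl; apply/cvgrPdist_le => e e0.
have K0 : 0 < `|K| + 1 by rewrite ltr_wpDl.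
near=> s.
rewrite (le_trans (cl t s))//.
apply: (@le_trans _ _ ((`|K| + 1) * `|t - s|)).
  by rewrite ler_wpM2r// (le_trans (ler_norm K))// lerDl.
rewrite mulrC -ler_pdivlMr//.
near: s; have := @cvg_id _ (nbhs t) => /cvgrPdist_le; apply.
by rewrite divr_gt0.
Unshelve. all: by end_near. Qed.

Section LevelSetLeaves.
Context (D : set 'rV[R]_m) (F : 'rV[R]_m -> R) (S : 'rV[R]_m -> set 'rV[R]_m).
Hypotheses (oD : open D) (sF : smooth_on D F)
  (dFn0 : forall u, D u -> exists v, 'D_v F u != 0)
  (SE : forall u, D u -> S u = [set v | 'D_v F u = 0]).

(** Near [p], the points of [L] are joined to [p] by Lipschitz paths inside [L]. There both d phi
    and d F have kernel [S], so [F] is stationary along the paths; connectedness of [L] makes the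
    conclusion global. *)
Lemma integral_manifold_cst L p q : integral_manifold D S L -> connected L ->
  L p -> L q -> F q = F p.
Proof.
move=> [LD HL] cL; apply: connected_locally_cst => // {}p Lp.
have [U [phi [[oU Up UD] [sphi dphi LU SU]]]] := HL p Lp.
have zero w : L w -> U w -> phi w = 0.
  by move=> Lw Uw; have : (L `&` U) w by []; rewrite LU => -[].
have [W [oW Wp WU cW]] := submersion_chart U phi p oU sphi Up (zero _ Lp Up) (dphi p Up).
exists W; split => // w Lw Ww.
have [c [K [<- <- cc cl]]] := cW p w Wp Ww (zero _ Lp Up) (zero _ Lw (WU _ Ww)).
apply: (@is_derive_0_is_cst R (fun t => F (c t))) => t.
have [Wt ct0] := cc t; have Ut := WU _ Wt.
apply: (is_derive_curve0 U F phi c K t oU (smooth_subset _ _ _ _ UD sF) sphi Ut _ cl).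
- by move=> s; have [] := cc s.
- exact: dphi.
- move=> v dv0.
  have Lct : L (c t) by have : (U `&` phi @^-1` [set 0]) (c t) by []; rewrite -LU => -[].
  have : S (c t) v by rewrite (SU _ Lct Ut).
  by rewrite SE//; exact: UD.
Qed.

Let dsub c u v : D u -> 'D_v (fun p => F p - c) u = 'D_v F u.
Proof.
move=> Du; have dF := smooth_derivable _ oD _ u v sF Du.
by rewrite (deriveB dF (@derivable_cst _ _ _ c u v)) derive_cst subr0.
Qed.

Let ssub c : smooth_on D (fun p => F p - c).
Proof. exact: (smoothD _ oD F (fun=> - c) sF (smooth_cst _ oD (- c))). Qed.

Lemma level_set_integral c : integral_manifold D S (level_set D F c).
Proof.
split=> [u []//|p [Dp Fp]]; exists D, (fun p => F p - c); split; split; [by []|by []|by []|exact: ssub| | |].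
- by move=> u Du; have [v dv] := dFn0 u Du; exists v; rewrite dsub.
- apply/seteqP; split => u.
    by move=> [[Du /= ->] _]; split => //=; rewrite subrr.
  by move=> [Du /= /eqP]; rewrite subr_eq0 => /eqP.
- by move=> u _ Du; rewrite SE//; apply/seteqP; split => v /=; rewrite dsub.
Qed.

(** A component of a set need not be open in it. Here the paths of [submersion_chart] place every
    point of the level set close to [p] in the component of [p]. *)
Lemma level_component_integral u : D u ->
  integral_manifold D S (connected_component (level_set D F (F u)) u).
Proof.
move=> Du; set A := level_set _ _ _; set C := connected_component A u.
have CA : C `<=` A by exact: connected_component_sub.
split=> [p /CA []//|p Cp]; have [Dp Fp] := CA _ Cp.
have dn : exists v, 'D_v (fun p => F p - F u) p != 0.
  by have [v dv] := dFn0 p Dp; exists v; rewrite dsub.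
have z0 : F p - F u = 0 by rewrite Fp subrr.
have [W [oW Wp WD cW]] := submersion_chart D _ p oD (ssub (F u)) Dp z0 dn.
(* The zero set in all of [D] could contain other components, hence the restriction to the chart
   [W]. *)
exists W, (fun p => F p - F u); split; split;
  [by []|by []|by []|exact: smooth_subset (ssub (F u))| | |].
- by move=> w /WD Dw; have [v dv] := dFn0 w Dw; exists v; rewrite dsub.
- apply/seteqP; split => w.
    by move=> [/CA[Dw /= Fw] Ww]; split => //=; rewrite Fw subrr.
  move=> [Ww /= w0]; split => //.
  have [c [K [c0 c1 cc cl]]] := cW p w Wp Ww z0 w0.
  apply: (@connected_component_trans _ A p u w); first exact: Cp.
  rewrite -c0 -c1.
  apply: (@connected_component_max _ A (c @` `[0, 1]) (c 0)).
  + by exists 0 => //=; rewrite in_itv /= lexx ler01.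
  + move=> _ [t _ <-]; have [/WD Dt ct] := cc t; split => //.
    by apply/eqP; rewrite -subr_eq0; apply/eqP.
  + apply: connected_continuous_connected; first exact: segment_connected.
    apply: continuous_subspaceT => t.
    exact: lipschitz_continuous cl.
  + by exists 1 => //=; rewrite in_itv /= lexx ler01.
- by move=> w _ /WD Dw; rewrite SE//; apply/seteqP; split => v /=; rewrite dsub.
Qed.

(** Leaves are connected while level sets may not be, hence the components. Constancy of [F]
    confines any connected integral manifold through [u] to the component of [u], which is itself
    one; maximality does the rest in both directions. *)
Lemma leaf_level_set L : leaf D S L <->
  exists2 u, D u & L = connected_component (level_set D F (F u)) u.
Proof.
split.
- move=> [[u Lu] iL cL maxL]; have [LD _] := iL; have Du := LD _ Lu.
  exists u => //; apply/esym/maxL.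
  + exact: level_component_integral.
  + exact: component_connected.
  + apply: connected_component_max => // w Lw; split; first exact: LD.
    exact: (integral_manifold_cst _ _ _ iL cL Lu Lw).
- move=> [u Du ->]; set A := level_set _ _ _.
  have Au : A u by [].
  have Cu := connected_component_refl Au.
  split.
  + by exists u.
  + exact: level_component_integral.
  + exact: component_connected.
  + move=> L' iL' cL' CL'; apply/seteqP; split => //.
    have L'u := CL' _ Cu; have [L'D _] := iL'.
    apply: connected_component_max => // w L'w; split; first exact: L'D.
    exact: (integral_manifold_cst _ _ _ iL' cL' L'u L'w).
Qed.

End LevelSetLeaves.

End Leaves.

(** * Null graphs *)

Section RowCons.
Context {R : realType} {n : nat}.
Implicit Types (f g c : R) (y z : 'rV[R]_n).

Definition row_cons f y : 'rV[R]_n.+1 :=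
  \row_(i < n.+1) if unlift ord0 i is Some a then y ord0 a else f.

Lemma row_cons0 f y : row_cons f y ord0 ord0 = f.
Proof. by rewrite mxE unlift_none. Qed.

Lemma row_consS f y a : row_cons f y ord0 (lift ord0 a) = y ord0 a.
Proof. by rewrite mxE liftK. Qed.

Lemma rowD y z a : (y + z) ord0 a = y ord0 a + z ord0 a.
Proof. by rewrite mxE. Qed.

Lemma rowZ c y a : (c *: y) ord0 a = c * y ord0 a.
Proof. by rewrite mxE. Qed.

Lemma row_consP (u v : 'rV[R]_n.+1) : u ord0 ord0 = v ord0 ord0 ->
  (forall a, u ord0 (lift ord0 a) = v ord0 (lift ord0 a)) -> u = v.
Proof.
by move=> u0 uS; apply/rowP => i; case: (unliftP ord0 i) => [a|] ->.
Qed.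

Lemma row_cons_inj f g y z : row_cons f y = row_cons g z -> f = g /\ y = z.
Proof.
move=> E; split; first by rewrite -(row_cons0 f y) E row_cons0.
by apply/rowP => a; rewrite -(row_consS f y) E row_consS.
Qed.

Lemma row_consD f g y z : row_cons f y + row_cons g z = row_cons (f + g) (y + z).
Proof.
by apply: row_consP => [|a]; rewrite mxE ?row_cons0 ?row_consS ?mxE.
Qed.

Lemma row_consZ c f y : c *: row_cons f y = row_cons (c * f) (c *: y).
Proof.
by apply: row_consP => [|a]; rewrite mxE ?row_cons0 ?row_consS ?mxE.
Qed.

Lemma row_consN f y : - row_cons f y = row_cons (- f) (- y).
Proof. by rewrite -scaleN1r row_consZ mulN1r scaleN1r. Qed.

Lemma derivable_row_cons (V : normedModType R) (f : V -> R) (y : V -> 'rV[R]_n) u v :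
  derivable f u v -> derivable y u v -> derivable (fun p => row_cons (f p) (y p)) u v.
Proof.
move=> df /derivable_rowP dy; apply/derivable_rowP => i.
case: (unliftP ord0 i) => [a|] ->.
  have -> : (fun p => row_cons (f p) (y p) ord0 (lift ord0 a)) = (fun p => y p ord0 a).
    by apply/funext => p; rewrite row_consS.
  exact: dy.
have -> : (fun p => row_cons (f p) (y p) ord0 ord0) = f.
  by apply/funext => p; rewrite row_cons0.
exact: df.
Qed.

Lemma derive_row_cons (V : normedModType R) (f : V -> R) (y : V -> 'rV[R]_n) u v :
  derivable f u v -> derivable y u v ->
  'D_v (fun p => row_cons (f p) (y p)) u = row_cons ('D_v f u) ('D_v y u).
Proof.
move=> df dy; have d := derivable_row_cons _ f y u v df dy.
apply: row_consP => [|a].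
  rewrite row_cons0 (derive_row_coord _ _ _ u v ord0 d); congr ('D_v _ u).
  by apply/funext => p; rewrite row_cons0.
rewrite row_consS (derive_row_coord _ _ _ u v (lift ord0 a) d).
rewrite (derive_row_coord _ _ _ u v a dy); congr ('D_v _ u).
by apply/funext => p; rewrite row_consS.
Qed.

(** The scalar product of the base space of index [q - 1]; the shift [a.+1] reflects that the
    ordinal [a] stands for the coordinate [u^{a+1}]. *)
Definition ip (q : nat) y z : R := \sum_(a < n) eps q a.+1 * y ord0 a * z ord0 a.

Lemma gbar_row_cons q f g y z : (0 < q)%N ->
  gbar q (row_cons f y) (row_cons g z) = ip q y z - f * g.
Proof.
move=> q0; rewrite /gbar big_ord_recl !row_cons0 /eps q0 mulN1r mulNr addrC.
by congr (_ - _); apply: eq_bigr => a _; rewrite !row_consS.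
Qed.

Lemma gbarC q (v w : 'rV[R]_n.+1) : gbar q v w = gbar q w v.
Proof. by apply: eq_bigr => i _; exact: mulrAC. Qed.

Lemma eps_sqr q i : eps q i * eps q i = 1 :> R.
Proof. by rewrite /eps; case: ifP; rewrite ?mulrNN mulr1. Qed.

Lemma ipC q y z : ip q y z = ip q z y.
Proof. by apply: eq_bigr => a _; rewrite mulrAC. Qed.

Lemma ipDZ q c y y' z : ip q (c *: y + y') z = c * ip q y z + ip q y' z.
Proof.
rewrite /ip mulr_sumr -big_split/=; apply: eq_bigr => a _.
by rewrite !mxE; ring.
Qed.

Lemma ipZ q c y z : ip q (c *: y) z = c * ip q y z.
Proof. by rewrite /ip mulr_sumr; apply: eq_bigr => a _; rewrite mxE; ring. Qed.

Lemma ip_coord q y a : ip q y (coord_vec a) = eps q a.+1 * y ord0 a.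
Proof.
rewrite /ip -(sum_coord_vec a (fun i => eps q i.+1 * y ord0 i)).
by apply: eq_bigr => i _; rewrite mulrC.
Qed.

Lemma is_derive_ip {m} q (Y Z : 'rV[R]_m -> 'rV[R]_n) u v :
  derivable Y u v -> derivable Z u v ->
  is_derive u v (fun p => ip q (Y p) (Z p))
    (ip q ('D_v Y u) (Z u) + ip q (Y u) ('D_v Z u)).
Proof.
move=> dY dZ.
pose g (a : 'I_n) : 'rV[R]_m -> R :=
  eps q a.+1 \*o ((fun p => Y p ord0 a) * (fun p => Z p ord0 a)).
have -> : (fun p => ip q (Y p) (Z p)) = \sum_a g a.
  by apply/funext => p; rewrite fct_sumE; apply: eq_bigr => a _; rewrite /g /= mulrA.
have der a : is_derive u v (g a)
    (eps q a.+1 * (Y u ord0 a *: 'D_v Z u ord0 a + Z u ord0 a *: 'D_v Y u ord0 a)).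
  have dYa := (derivable_rowP _ _ Y u v).1 dY a.
  have dZa := (derivable_rowP _ _ Z u v).1 dZ a.
  rewrite (derive_row_coord _ _ Y u v a dY) (derive_row_coord _ _ Z u v a dZ).
  have dm := derivableM dYa dZa.
  split; first exact: (derivableM (derivable_cst (eps q a.+1) u v) dm).
  by rewrite /g (deriveMl (eps q a.+1) dm) (deriveM dYa dZa).
apply: is_derive_eq (is_derive_sum der) _.
rewrite /ip -big_split/=; apply: eq_bigr => a _.
rewrite /GRing.scale /=.
by move: (eps q a.+1) (Y u _ _) (Z u _ _) ('D_v Y u _ _) ('D_v Z u _ _) => *; ring.
Qed.

Lemma is_derive_scale_row {m} (f : 'rV[R]_m -> R) (Y : 'rV[R]_m -> 'rV[R]_n) u v :
  derivable f u v -> derivable Y u v ->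
  is_derive u v (fun p => f p *: Y p) (f u *: 'D_v Y u + 'D_v f u *: Y u).
Proof.
move=> df dY.
have dYa a := (derivable_rowP _ _ Y u v).1 dY a.
have E a : (fun p => (f p *: Y p) ord0 a) = f * (fun p => Y p ord0 a).
  by apply/funext => p; rewrite mxE.
have d : derivable (fun p => f p *: Y p) u v.
  by apply/derivable_rowP => a; rewrite E; exact: derivableM df (dYa a).
split; first exact: d.
apply/rowP => a; rewrite (derive_row_coord _ _ _ u v a d) E (deriveM df (dYa a)).
rewrite !mxE (derive_row_coord _ _ Y u v a dY).
by rewrite [Y u _ _ *: _]mulrC.
Qed.

Lemma graphE (F : 'rV[R]_n -> R) u : graph F u = row_cons (F u) u.
Proof. by []. Qed.

Lemma graph_base_graph (F : 'rV[R]_n -> R) u : graph_base (graph F u) = u.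
Proof. by apply/rowP => a; rewrite mxE graphE row_consS. Qed.

Lemma monge_riggingE q (F : 'rV[R]_n -> R) (p : 'rV[R]_n.+1) :
  monge_rigging q F p = (Num.sqrt 2)^-1 *:
    row_cons (-1) (\row_a (eps q a.+1 * partial a F (graph_base p))).
Proof.
congr (_ *: _); apply: row_consP => [|a].
  rewrite row_cons0 2!mxE coord_vec_id summxE big1 ?addr0// => a _.
  by rewrite !mxE/= mulr0.
rewrite row_consS 2!mxE summxE (bigD1 a)//= [coord_vec ord0]/coord_vec !mxE !eqxx/=.
rewrite oppr0 add0r mulr1 big1 ?addr0// => b ba.
by rewrite !mxE/= (inj_eq lift_inj) eq_sym (negbTE ba) mulr0.
Qed.

End RowCons.

(** * Geometry of a Monge null hypersurface *)

Section Monge.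
Context {R : realType} (n q : nat) (q0 : (0 < q)%N) (D : set 'rV[R]_n) (oD : open D)
  (F : 'rV[R]_n -> R) (sF : smooth_on D F)
  (nullM : null_hypersurface q D (graph F)).
Implicit Types (u v w y z p : 'rV[R]_n) (X Y Z : 'rV[R]_n -> 'rV[R]_n).

Local Notation x := (graph F).
Local Notation N := (monge_rigging q F).
Local Notation s := (Num.sqrt (2 : R)).

Let s_gt0 : 0 < s. Proof. by rewrite sqrtr_gt0. Qed.
Let s_neq0 : s != 0. Proof. by rewrite gt_eqF. Qed.
Let s_sqr : s * s = 2. Proof. by rewrite -expr2 sqr_sqrtr. Qed.

Let s_invD : s^-1 + s^-1 = s.
Proof. by apply: (mulfI s_neq0); rewrite mulrDr mulfV// s_sqr. Qed.

Definition grad u : 'rV[R]_n := \row_a (eps q a.+1 * partial a F u).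

(** An asymmetric form of the Hessian: linearity in [w] is immediate, while linearity in [v] is
    obtained from the symmetry [hessC]. *)
Definition hess u v w : R := \sum_b w ord0 b * 'D_v (partial b F) u.

Lemma dF_derivable u v : D u -> derivable F u v.
Proof. exact: smooth_derivable. Qed.

Lemma dFE u v : D u -> 'D_v F u = \sum_a v ord0 a * partial a F u.
Proof. exact: smooth_deriveE. Qed.

Lemma dFZD u c v w : D u -> 'D_(c *: v + w) F u = c * 'D_v F u + 'D_w F u.
Proof. exact: smooth_deriveZD. Qed.

Lemma dFZ u c v : D u -> 'D_(c *: v) F u = c * 'D_v F u.
Proof. by move=> Du; rewrite -[c *: v]addr0 dFZD// derive0 addr0. Qed.

Lemma dFD u v w : D u -> 'D_(v + w) F u = 'D_v F u + 'D_w F u.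
Proof. by move=> Du; rewrite -[v]scale1r dFZD// mul1r scale1r. Qed.

Lemma dFN u v : D u -> 'D_(- v) F u = - 'D_v F u.
Proof. by move=> Du; rewrite -scaleN1r dFZ// mulN1r. Qed.

Lemma ip_grad u v : D u -> ip q (grad u) v = 'D_v F u.
Proof.
move=> Du; rewrite dFE//; apply: eq_bigr => a _.
by rewrite mxE mulrA eps_sqr mul1r mulrC.
Qed.

Lemma pushE u v : D u -> push x u v = row_cons ('D_v F u) v.
Proof.
move=> Du.
have := derive_row_cons _ F id u v (dF_derivable u v Du) (@derivable_id R _ u v).
by rewrite derive_id.
Qed.

Lemma induced_metricE u v w : D u ->
  induced_metric q x u v w = ip q v w - 'D_v F u * 'D_w F u.
Proof. by move=> Du; rewrite /induced_metric !pushE// gbar_row_cons. Qed.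

(** Testing degeneracy against the coordinate vectors solves for each component of [v]: the radical
    lies in the line of the gradient. *)
Lemma radical u v : D u -> (forall w, induced_metric q x u v w = 0) ->
  v = 'D_v F u *: grad u.
Proof.
move=> Du H; apply/rowP => a; have := H (coord_vec a).
rewrite induced_metricE// ip_coord !mxE -/(partial a F u) => /subr0_eq E.
by rewrite mulrCA -E mulrA eps_sqr mul1r.
Qed.

(** A nonzero radical vector satisfies v = dF(v) G, so dF(v) is nonzero; applying dF to this
    equation and cancelling dF(v) gives the value. The nullity hypothesis enters here. *)
Lemma dF_grad u : D u -> 'D_(grad u) F u = 1.
Proof.
move=> Du; have [v v0 H] := nullM u Du.
have vE := radical u v Du H.
have dv0 : 'D_v F u != 0.
  by apply: contra v0 => /eqP d0; rewrite vE d0 scale0r.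
apply: (mulfI dv0); rewrite mulr1 -dFZ//.
by rewrite -vE.
Qed.

Lemma N_graph p : N (x p) = row_cons (- s^-1) (s^-1 *: grad p).
Proof. by rewrite monge_riggingE row_consZ mulrN1 graph_base_graph. Qed.

(** The [x^0] component and the remaining ones each contribute [s^-1] times dF. *)
Lemma etaE u v : D u -> eta q x N u v = s * 'D_v F u.
Proof.
move=> Du; rewrite /eta N_graph pushE// gbar_row_cons//.
by rewrite ipZ ip_grad// mulNr opprK -mulrDl s_invD.
Qed.

Lemma screenE u : D u -> screen q x N u = [set v | 'D_v F u = 0].
Proof.
move=> Du; apply/seteqP; split => v /=; rewrite /screen/= etaE//.
  by move=> /eqP; rewrite mulf_eq0 (negbTE s_neq0) => /eqP.
by move=> ->; rewrite mulr0.
Qed.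

Lemma spartial b : smooth_on D (partial b F).
Proof. exact: smooth_partial. Qed.

Lemma hessE u v w : D u ->
  hess u v w = \sum_b \sum_a v ord0 a * w ord0 b * partial a (partial b F) u.
Proof.
move=> Du; apply: eq_bigr => b _.
rewrite (smooth_deriveE D oD (partial b F) u v (spartial b) Du) mulr_sumr.
by apply: eq_bigr => a _; rewrite mulrA [w _ _ * _]mulrC.
Qed.

Lemma hessC u v w : D u -> hess u v w = hess u w v.
Proof.
move=> Du; rewrite !hessE// exchange_big/=.
apply: eq_bigr => a _; apply: eq_bigr => b _.
by rewrite (partialC D oD F a b u sF Du) [v _ _ * _]mulrC.
Qed.

Lemma hess_linr u v c w w' : hess u v (c *: w + w') = c * hess u v w + hess u v w'.
Proof.
rewrite /hess mulr_sumr -big_split/=; apply: eq_bigr => b _.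
by rewrite !mxE mulrDl mulrA.
Qed.

Lemma hess_linl u v v' c w : D u ->
  hess u (c *: v + v') w = c * hess u v w + hess u v' w.
Proof. by move=> Du; rewrite ![hess u _ w]hessC// hess_linr. Qed.

Lemma hessZr u v c w : hess u v (c *: w) = c * hess u v w.
Proof.
rewrite -[c *: w]addr0 hess_linr.
by rewrite [hess u v 0]big1 ?addr0// => b _; rewrite mxE mul0r.
Qed.

Lemma derive_dF u v Y : D u -> derivable Y u v ->
  is_derive u v (fun p => 'D_(Y p) F p) (hess u v (Y u) + 'D_('D_v Y u) F u).
Proof.
move=> Du dY.
pose g a : 'rV[R]_n -> R := (fun p => Y p ord0 a) * partial a F.
have gE p : D p -> (\sum_a g a) p = 'D_(Y p) F p.
  by move=> Dp; rewrite dFE// fct_sumE; apply: eq_bigr.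
have der a : is_derive u v (g a)
    (Y u ord0 a *: 'D_v (partial a F) u + partial a F u *: 'D_v Y u ord0 a).
  apply: is_deriveM.
    rewrite (derive_row_coord _ _ Y u v a dY).
    exact: derivableP ((derivable_rowP _ _ Y u v).1 dY a).
  exact: derivableP (smooth_derivable D oD _ u v (spartial a) Du).
have df : is_derive u v (\sum_a g a) (hess u v (Y u) + 'D_('D_v Y u) F u).
  have dsum := is_derive_sum der; apply: is_derive_eq dsum _.
  rewrite big_split/= dFE//; congr (_ + _).
  by apply: eq_bigr => a _; exact: mulrC.
apply: near_eq_is_derive df.
exact: near_eq_on gE Du.
Qed.

Lemma sgrad : smooth_on D grad.
Proof.
apply/(smooth_rowP D oD) => a.
have -> : (fun u => grad u ord0 a) = (fun u => eps q a.+1 * partial a F u).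
  by apply/funext => u; rewrite mxE.
exact: (smoothM D oD (fun=> eps q a.+1) (partial a F) (smooth_cst D oD _) (spartial a)).
Qed.

Lemma dgrad u v : D u -> derivable grad u v.
Proof. by move=> Du; exact: smooth_row_derivable D oD n grad u v sgrad Du. Qed.

(** Raising the index by the constants [eps] commutes with differentiation, and both sides are the
    same sum. *)
Lemma dF_dgrad u v : D u -> 'D_('D_v grad u) F u = hess u v (grad u).
Proof.
move=> Du; rewrite dFE//; apply: eq_bigr => a _.
rewrite (derive_row_coord _ _ grad u v a (dgrad u v Du)).
have -> : (fun p => grad p ord0 a) = eps q a.+1 \*o partial a F.
  by apply/funext => p; rewrite mxE.
rewrite (deriveMl (eps q a.+1) (smooth_derivable D oD _ u v (spartial a) Du)).
by rewrite mxE; rewrite mulrAC.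
Qed.

Lemma hess_grad u v : D u -> hess u v (grad u) = 0.
Proof.
move=> Du; have [_] := derive_dF u v grad Du (dgrad u v Du).
have c1 := derive_eq_on D (fun p => 'D_(grad p) F p) (fun=> (1 : R)) oD dF_grad u v Du.
rewrite c1 derive_cst dF_dgrad// => /esym/eqP.
by rewrite -mulr2n mulrn_eq0 => /eqP.
Qed.

Lemma nabla_bar_push u v Y : D u -> derivable Y u v ->
  nabla_bar u v (fun p => push x p (Y p)) =
  row_cons (hess u v (Y u) + 'D_('D_v Y u) F u) ('D_v Y u).
Proof.
move=> Du dY; have d1 := derive_dF u v Y Du dY.
have E p : D p -> push x p (Y p) = row_cons ('D_(Y p) F p) (Y p) by move=> /pushE.
rewrite /nabla_bar (derive_eq_on D _ _ oD E u v Du).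
rewrite (derive_row_cons _ (fun p => 'D_(Y p) F p) Y u v (@ex_derive _ _ _ _ _ _ _ d1) dY).
by rewrite (@derive_val _ _ _ _ _ _ _ d1).
Qed.

(** The equation reads (h + d, w) = (dF z, z) + b/s (-1, G). Applying dF to the second component
    gives d = dF z + b/s; comparison with the first yields h = - 2 b/s, which determines [b] and
    then [z]. *)
Lemma nabla_atE u v Y : D u -> derivable Y u v ->
  nabla_at x N u v Y = 'D_v Y u + (hess u v (Y u) / 2) *: grad u.
Proof.
move=> Du dY; rewrite /nabla_at /gauss nabla_bar_push// N_graph.
set h := hess _ _ _; set w := 'D_v Y u; set d := 'D_w F u.
rewrite (@get_unique _ _ (w + (h / 2) *: grad u, - (s * h / 2)))//=.
  rewrite pushE// row_consZ row_consD dFD// dFZ// dF_grad// mulr1 -/d.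
  congr row_cons.
    rewrite mulrN mulNr opprK.
    have -> : s * h / 2 * s^-1 = h / 2 by field.
    by move: (h) (d) => a b; lra.
  rewrite -addrA scalerA -scalerDl.
  have -> : h / 2 + - (s * h / 2) * s^-1 = 0 by field.
  by rewrite scale0r addr0.
move=> [z b] /=; rewrite pushE// row_consZ row_consD => /row_cons_inj[E1 E2].
have E3 : d = 'D_z F u + b / s.
  by rewrite /d E2 dFD// scalerA dFZ// dF_grad// mulr1.
have bE : b = - (s * h / 2).
  have {}E1 : b / s = - h / 2.
    by move: E1; rewrite E3 mulrN; move: (b / s) (h) ('D_z F u) => *; lra.
  by rewrite -[b](divfK s_neq0) E1; field.
congr pair => //; rewrite E2 bE scalerA -addrA -scalerDl.
have -> : - (s * h / 2) / s + h / 2 = 0 by field.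
by rewrite scale0r addr0.
Qed.

Lemma weingartenE u v : D u -> weingarten q x N u v = (- (s^-1 *: 'D_v grad u), 0).
Proof.
move=> Du; rewrite /weingarten.
have -> : nabla_bar u v (N \o x) = row_cons 0 (s^-1 *: 'D_v grad u).
  rewrite /nabla_bar.
  have -> : N \o x = (fun p => row_cons (- s^-1) (s^-1 *: grad p)).
    by apply/funext => p; exact: N_graph.
  have dg := dgrad u v Du.
  rewrite (derive_row_cons _ (fun=> - s^-1) (fun p => s^-1 *: grad p) u v).
  - by rewrite derive_cst (deriveZ s^-1 dg).
  - exact: derivable_cst.
  - exact: derivableZ dg.
(* This puts the derivative of the gradient in the screen and makes the derivative of the rigging
   tangent to the graph. *)
have dg0 : 'D_('D_v grad u) F u = 0 by rewrite dF_dgrad// hess_grad.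
rewrite N_graph; apply: get_unique => /=.
  rewrite etaE// dFN// dFZ// dg0 mulr0 oppr0 mulr0 scale0r addr0 pushE// dFN// dFZ// dg0.
  by rewrite mulr0 oppr0 row_consN oppr0 opprK.
(* For uniqueness, the screen condition kills dF(a), so the [x^0] component of the equation reduces
   to [t / s = 0]. *)
move=> [a t] /=; rewrite etaE// => -[/eqP]; rewrite mulf_eq0 (negbTE s_neq0) => /eqP a0.
rewrite pushE// a0 row_consN row_consZ row_consD oppr0 add0r => /row_cons_inj[/esym/eqP].
rewrite mulrN oppr_eq0 mulf_eq0 invr_eq0 (negbTE s_neq0) orbF => /eqP -> E.
by rewrite E scale0r addr0 opprK.
Qed.

Lemma riggedE u : D u -> rigged q x N u = s^-1 *: grad u.
Proof.
move=> Du; apply: get_unique => /=.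
  have dG : 'D_(s^-1 *: grad u) F u = s^-1 by rewrite dFZ// dF_grad// mulr1.
  split=> [w|].
    by rewrite induced_metricE// dG ipZ ip_grad// subrr.
  by rewrite gbarC -/(eta q x N u _) etaE// dG mulfV.
move=> v [H1]; rewrite gbarC -/(eta q x N u v) etaE// => H2.
rewrite (radical u v Du H1); congr (_ *: _).
by apply: (mulfI s_neq0); rewrite H2 mulfV.
Qed.

Lemma rotationE u v : D u -> rotation q x N u v = 0.
Proof. by move=> Du; rewrite /rotation weingartenE. Qed.

Lemma shape_opE u v : D u -> shape_op q x N u v = - (s^-1 *: 'D_v grad u).
Proof. by move=> Du; rewrite /shape_op weingartenE. Qed.

(** The closed form of [rigged] holds only on [D]; locality of the derivative allows its
    substitution under [nabla_at]. *)
Lemma nabla_at_eq_on u v Y Z : D u -> (forall p, D p -> Y p = Z p) ->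
  nabla_at x N u v Y = nabla_at x N u v Z.
Proof.
move=> Du YZ; rewrite /nabla_at /gauss.
have E p : D p -> push x p (Y p) = push x p (Z p) by move=> /YZ ->.
by rewrite /nabla_bar (derive_eq_on D _ _ oD E u v Du).
Qed.

Lemma screen_shape_opE u v : D u ->
  screen_shape_op q x N u v = - (s^-1 *: 'D_v grad u).
Proof.
move=> Du; rewrite /screen_shape_op rotationE// scale0r.
have dg := dgrad u v Du.
have -> : nabla_at x N u v (rigged q x N) = s^-1 *: 'D_v grad u.
  rewrite (nabla_at_eq_on u v _ (fun p => s^-1 *: grad p) Du riggedE).
  rewrite (nabla_atE u v (fun p => s^-1 *: grad p) Du (@derivableZ R _ _ grad s^-1 u v dg)).
  by rewrite (deriveZ s^-1 dg) hessZr hess_grad// mulr0 mul0r scale0r addr0.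
have dg0 : 'D_('D_v grad u) F u = 0 by rewrite dF_dgrad// hess_grad.
apply: get_unique => /=.
  by rewrite etaE// dFN// dFZ// dg0 mulr0 oppr0 mulr0 subr0 opprK.
by move=> a [_ ->]; rewrite subr0 opprK.
Qed.

(** * The rigging as a smooth lightlike transverse field on the cylinder over D *)

Lemma graph_baseZD c (v w : 'rV[R]_n.+1) :
  graph_base (c *: v + w) = c *: graph_base v + graph_base w.
Proof. by apply/rowP => a; rewrite !mxE. Qed.

Lemma is_derive_graph_base (h : 'rV[R]_n -> R) (p v : 'rV[R]_n.+1) :
  derivable h (graph_base p) (graph_base v) ->
  is_derive p v (h \o graph_base) ('D_(graph_base v) h (graph_base p)).
Proof.
have E : (fun k : R => k^-1 *: (((h \o graph_base) \o shift p) (k *: v) - (h \o graph_base) p))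
  = (fun k : R => k^-1 *: ((h \o shift (graph_base p)) (k *: graph_base v) - h (graph_base p))).
  by apply/funext => k /=; rewrite graph_baseZD.
by move=> dh; split; rewrite /derivable /derive E.
Qed.

Lemma continuous_graph_base : continuous (@graph_base R n).
Proof.
move=> r; apply: continuous_row => a.
have -> : (fun p : 'rV[R]_n.+1 => graph_base p ord0 a) = (fun p : 'rV[R]_n.+1 => p ord0 (lift ord0 a)).
  by apply/funext => t; rewrite mxE.
exact: coord_continuous.
Qed.

Lemma open_cylinder : open (@graph_base R n @^-1` D).
Proof. by apply: open_comp oD => p _; exact: continuous_graph_base. Qed.

(** Pull-backs along the projection are stable under partial derivatives: the one along [x^0]
    vanishes, the others are pull-backs of partials. *)
Lemma smooth_graph_base (h : 'rV[R]_n -> R) : smooth_on D h ->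
  smooth_on (@graph_base R n @^-1` D) (h \o graph_base).
Proof.
move=> sh; apply: (smooth_coind _ open_cylinder [set f | exists2 k, smooth_on D k &
  f = k \o graph_base]); last by exists h.
- move=> _ [k sk ->] p Dp; split.
    exact: (continuous_comp (@continuous_graph_base p) (smooth_continuous _ _ _ sk Dp)).
  move=> i; have dk := smooth_derivable D oD k _ (graph_base (coord_vec i)) sk Dp.
  by have [] := is_derive_graph_base k p (coord_vec i) dk.
- move=> _ i [k sk ->].
  have dk (p : 'rV[R]_n.+1) : D (graph_base p) -> partial i (k \o graph_base) p =
      'D_(graph_base (coord_vec i)) k (graph_base p).
    move=> Dp; have dk := smooth_derivable D oD k _ (graph_base (coord_vec i)) sk Dp.
    by have [] := is_derive_graph_base k p (coord_vec i) dk.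
  case: (unliftP ord0 i) dk => [a|] ->.
    have -> : graph_base (coord_vec (lift ord0 a)) = coord_vec a :> 'rV[R]_n.
      by apply/rowP => b; rewrite !mxE /= (inj_eq lift_inj).
    move=> dk; exists (partial a k \o graph_base); last exact: dk.
    by exists (partial a k); first exact: smooth_partial.
  have -> : graph_base (coord_vec ord0) = 0 :> 'rV[R]_n.
    by apply/rowP => b; rewrite !mxE.
  move=> dk; exists ((fun=> 0) \o graph_base).
    by exists (fun=> 0); first exact: smooth_cst.
  by move=> p Dp; rewrite dk// derive0.
Qed.

Lemma monge_rigging_smooth : smooth_on (@graph_base R n @^-1` D) N.
Proof.
apply/(smooth_rowP _ open_cylinder) => i; case: (unliftP ord0 i) => [a|] ->.
  have -> : (fun p : 'rV[R]_n.+1 => N p ord0 (lift ord0 a)) =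
      (fun p : 'rV[R]_n.+1 => (s^-1 * eps q a.+1) * (partial a F \o graph_base) p).
    by apply/funext => p; rewrite monge_riggingE mxE row_consS mxE mulrA.
  exact: (smoothM _ open_cylinder (fun=> s^-1 * eps q a.+1) _ (smooth_cst _ open_cylinder _)
    (smooth_graph_base _ (spartial a))).
have -> : (fun p : 'rV[R]_n.+1 => N p ord0 ord0) = (fun=> - s^-1).
  by apply/funext => p; rewrite monge_riggingE mxE row_cons0 mulrN1.
exact: (smooth_cst _ open_cylinder _).
Qed.

Lemma monge_null_rigging : null_rigging q D x N.
Proof.
split.
  exists (@graph_base R n @^-1` D); split; first exact: open_cylinder.
  - by move=> _ [u Du <-]; rewrite /preimage/= graph_base_graph.
  - exact: monge_rigging_smooth.
move=> u Du; rewrite N_graph; split.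
- apply/eqP => /(congr1 (fun v : 'rV[R]_n.+1 => v ord0 ord0)) /eqP.
  by rewrite row_cons0 mxE oppr_eq0 invr_eq0 (negbTE s_neq0).
- by rewrite gbar_row_cons// ipZ ip_grad// dFZ// dF_grad// mulr1 mulrNN subrr.
(* A tangent rigging would have [v] equal to [s^-1] times the gradient, so dF(v) would be both
   [s^-1] and [- s^-1]. *)
- move=> [v]; rewrite pushE// => /row_cons_inj[E1 E2].
  move: E1; rewrite E2 dFZ// dF_grad// mulr1 => /eqP.
  by rewrite -addr_eq0 s_invD (negbTE s_neq0).
Qed.

Lemma monge_closed : closed_form D (eta q x N).
Proof.
move=> u v w Du.
have E y z : 'D_y (fun p => eta q x N p z) u = s * hess u y z.
  have dz := derive_dF u y (fun=> z) Du (@derivable_cst R _ _ z u y).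
  rewrite (derive_eq_on D _ (s \*o (fun p => 'D_z F p)) oD _ u y Du); last first.
    by move=> p Dp; exact: etaE.
  rewrite (deriveMl s (@ex_derive _ _ _ _ _ _ _ dz)) (@derive_val _ _ _ _ _ _ _ dz).
  by rewrite derive_cst dFE// [X in _ + X]big1 ?addr0// => a _; rewrite mxE mul0r.
by rewrite /ext_deriv (E v w) (E w v) (hessC u v w Du) subrr.
Qed.

Lemma monge_conformal : conformal_screen q D x N (fun=> 1).
Proof.
split; first exact: smooth_cst.
  by move=> u _; exact: oner_neq0.
by move=> u v Du; rewrite shape_opE// screen_shape_opE// scale1r.
Qed.

Lemma dF_neq0 u : D u -> exists v, 'D_v F u != 0.
Proof. by move=> Du; exists (grad u); rewrite dF_grad// oner_neq0. Qed.

Lemma monge_screen_leaves :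
  integrable_distribution D (screen q x N) /\
   (forall c : R, integral_manifold D (screen q x N) (level_set D F c)) /\
   (forall L : set 'rV[R]_n, leaf D (screen q x N) L <->
      exists2 u, D u & L = connected_component (level_set D F (F u)) u).
Proof.
have I c := level_set_integral D F (screen q x N) oD sF dF_neq0 screenE c.
split; first by move=> u Du; exists (level_set D F (F u)).
split; first exact: I.
by move=> L; exact: leaf_level_set oD sF dF_neq0 screenE L.
Qed.

(** * The induced connection, its divergence and the associated metric *)

Lemma induced_connectionE X Y u : smooth_on D Y -> D u ->
  induced_connection x N X Y u =
  'D_(X u) Y u + (hess u (X u) (Y u) / 2) *: grad u.
Proof.
move=> sY Du; exact: nabla_atE u (X u) Y Du (smooth_row_derivable D oD _ Y u (X u) sY Du).
Qed.

(** The correction to the flat derivative is the rank-one map sending [v] to Hess F (v, X) G / 2;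
    its trace is Hess F (X, G) / 2, which vanishes by [hess_grad]. *)
Lemma divergenceE X u : smooth_on D X -> D u ->
  divergence x N X u = \sum_(a < n) partial a (fun p => X p ord0 a) u.
Proof.
move=> sX Du.
have dX v := smooth_row_derivable D oD _ X u v sX Du.
have E a : lin1_mx (fun v => nabla_at x N u v X) a a =
    partial a (fun p => X p ord0 a) u + hess u (X u) (coord_vec a) / 2 * grad u ord0 a.
  rewrite mxE (nabla_atE u _ X Du (dX _)) rowD rowZ hessC//.
  by rewrite (derive_row_coord _ _ X u _ a (dX _)).
rewrite /divergence /mxtrace (eq_bigr _ (fun a _ => E a)) big_split/=.
rewrite [X in _ + X](_ : _ = hess u (X u) (grad u) / 2).
  by rewrite hess_grad// mul0r addr0.
rewrite {2}/hess mulr_suml; apply: eq_bigr => a _.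
by rewrite /hess sum_coord_vec mulrC mulrA.
Qed.

(** The square of [s] makes [eta] contribute twice dF (v) dF (w), turning the minus sign of the
    induced metric into a plus. *)
Lemma associated_metricE u v w : D u ->
  associated_metric q x N u v w = ip q v w + 'D_v F u * 'D_w F u.
Proof.
move=> Du; rewrite /associated_metric induced_metricE// !etaE//.
have -> : s * 'D_v F u * (s * 'D_w F u) = 2 * ('D_v F u * 'D_w F u).
  by rewrite mulrACA s_sqr.
by move: (ip _ _ _) ('D_v F u * _) => a b; lra.
Qed.

Lemma associated_metricC u v w : D u ->
  associated_metric q x N u v w = associated_metric q x N u w v.
Proof.
move=> Du; rewrite (associated_metricE u v w Du) (associated_metricE u w v Du).
by rewrite (ipC q v w) ['D_v F u * _]mulrC.
Qed.

(** The gradient pairs with [w] to 2 dF(w), which cancels the 1/2 in the connection. *)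
Lemma associated_metric_grad u v c w : D u ->
  associated_metric q x N u (v + c *: grad u) w =
  ip q v w + 'D_v F u * 'D_w F u + 2 * c * 'D_w F u.
Proof.
move=> Du; rewrite associated_metricE// [v + _]addrC ipDZ dFZD// ip_grad// dF_grad//.
by move: (ip _ _ _) ('D_v F u) ('D_w F u) => *; ring.
Qed.

Lemma ip_eq0 v : (forall w, ip q v w = 0) -> v = 0.
Proof.
move=> H; apply/rowP => a; rewrite mxE.
by have := H (coord_vec a); rewrite ip_coord => H1; rewrite -[v _ _]mul1r -(eps_sqr q a.+1) -mulrA H1 mulr0.
Qed.

Lemma monge_semi_riemannian : semi_riemannian D (associated_metric q x N).
Proof.
split.
  move=> v w.
  apply: (smooth_eq_on D oD (fun u => ip q v w + 'D_v F u * 'D_w F u)).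
    by move=> u Du; rewrite associated_metricE.
  apply: (smoothD D oD (fun=> ip q v w)); first exact: smooth_cst.
  apply: (smoothM D oD (fun u => 'D_v F u) (fun u => 'D_w F u)).
    exact: (smooth_derive D oD (fun=> v) F (smooth_cst D oD v) sF).
  exact: (smooth_derive D oD (fun=> w) F (smooth_cst D oD w) sF).
move=> u Du; split.
- by move=> v w; exact: associated_metricC.
- move=> c v v' w; rewrite !associated_metricE// ipDZ dFZD//.
  by move: (ip _ _ _) (ip _ _ _) ('D_v F u) ('D_v' F u) ('D_w F u) => *; ring.
- move=> v H.
  (* Pairing with the gradient gives 2 dF(v); once this vanishes, only the nondegenerate [ip]
     remains. *)
  have dv : 'D_v F u = 0.
    have := H (grad u); rewrite associated_metricE// ipC ip_grad// dF_grad// mulr1.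
    by move/eqP; rewrite -mulr2n mulrn_eq0 => /eqP.
  apply: ip_eq0 => w; have := H w.
  by rewrite associated_metricE// dv mul0r addr0.
Qed.

Lemma smooth_row_deriveZD (X : 'rV[R]_n -> 'rV[R]_n) u c v w : smooth_on D X -> D u ->
  'D_(c *: v + w) X u = c *: 'D_v X u + 'D_w X u.
Proof.
move=> sX Du; apply/rowP => a.
rewrite rowD rowZ (smooth_row_deriveE D oD n X u (c *: v + w) a sX Du).
rewrite (smooth_row_deriveE D oD n X u v a sX Du) (smooth_row_deriveE D oD n X u w a sX Du).
exact: (smooth_deriveZD D _ u c v w oD ((smooth_rowP D oD n X).1 sX a) Du).
Qed.

Lemma induced_connection_smooth X Y : smooth_on D X -> smooth_on D Y ->
  smooth_on D (induced_connection x N X Y).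
Proof.
move=> sX sY.
apply: (smooth_eq_on D oD (fun u => 'D_(X u) Y u + (hess u (X u) (Y u) / 2) *: grad u)).
  by move=> u Du; rewrite (induced_connectionE X Y u sY Du).
apply/(smooth_rowP D oD) => a.
have sYa b := (smooth_rowP D oD n Y).1 sY b.
apply: (smooth_eq_on D oD (fun u => 'D_(X u) (fun p => Y p ord0 a) u +
    hess u (X u) (Y u) * (2^-1 * grad u ord0 a))).
  by move=> u Du; rewrite rowD rowZ (smooth_row_deriveE D oD n Y u _ a sY Du) mulrA.
apply: (smoothD D oD (fun u => 'D_(X u) (fun p => Y p ord0 a) u)).
  exact: (smooth_derive D oD X _ sX (sYa a)).
apply: (smoothM D oD (fun u => hess u (X u) (Y u)) (fun u => 2^-1 * grad u ord0 a)).
  apply: (smooth_sum D oD _ _ (fun b u => Y u ord0 b * 'D_(X u) (partial b F) u)) => b.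
  apply: (smoothM D oD (fun u => Y u ord0 b) (fun u => 'D_(X u) (partial b F) u)).
    exact: sYa.
  exact: (smooth_derive D oD X (partial b F) sX (spartial b)).
apply: (smoothM D oD (fun=> 2^-1) (fun u => grad u ord0 a)); first exact: smooth_cst.
exact: (smooth_rowP D oD n grad).1 sgrad a.
Qed.

Lemma induced_connection_affine : affine_connection D (induced_connection x N).
Proof.
move=> X Y Z f sX sY sZ sf; split; first exact: induced_connection_smooth.
move=> u Du.
have dY v := smooth_row_derivable D oD n Y u v sY Du.
have dZ v := smooth_row_derivable D oD n Z u v sZ Du.
have df v := smooth_derivable D oD f u v sf Du.
split.
- rewrite !(induced_connectionE _ Z u sZ Du).
  have := smooth_row_deriveZD Z u 1 (X u) (Y u) sZ Du; rewrite !scale1r => ->.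
  have := hess_linl u (X u) (Y u) 1 (Z u) Du; rewrite scale1r mul1r => ->.
  by rewrite mulrDl scalerDl addrACA.
- rewrite !(induced_connectionE _ Y u sY Du).
  have := smooth_row_deriveZD Y u (f u) (X u) 0 sY Du; rewrite addr0 derive0 addr0 => ->.
  have := hess_linl u (X u) 0 (f u) (Y u) Du; rewrite addr0 => ->.
  have -> : hess u 0 (Y u) = 0.
    by rewrite /hess big1// => b _; rewrite derive0 mulr0.
  by rewrite addr0 -mulrA -scalerA scalerDr.
- rewrite (induced_connectionE X Y u sY Du) (induced_connectionE X Z u sZ Du).
  rewrite /induced_connection (nabla_atE u (X u) (fun p => Y p + Z p) Du (derivableD (dY _) (dZ _))).
  rewrite (deriveD (dY (X u)) (dZ (X u))).
  have := hess_linr u (X u) 1 (Y u) (Z u); rewrite scale1r mul1r => ->.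
  by rewrite mulrDl scalerDl addrACA.
- have dfY := is_derive_scale_row f Y u (X u) (df _) (dY _).
  rewrite (induced_connectionE X Y u sY Du).
  rewrite /induced_connection (nabla_atE u (X u) _ Du (@ex_derive _ _ _ _ _ _ _ dfY)).
  rewrite (@derive_val _ _ _ _ _ _ _ dfY) hessZr -mulrA -scalerA.
  by rewrite scalerDr addrAC.
Qed.

(** Differentiating dF(Y) dF(Z) leaves the terms Hess F (X, Y) dF(Z) and dF(Y) Hess F (X, Z). These
    are the pairings of the two correction terms of the connection with [Z] and [Y]. *)
Lemma induced_connection_metric X Y Z u :
  smooth_on D X -> smooth_on D Y -> smooth_on D Z -> D u ->
  'D_(X u) (fun p => associated_metric q x N p (Y p) (Z p)) u =
    associated_metric q x N u (induced_connection x N X Y u) (Z u) +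
    associated_metric q x N u (Y u) (induced_connection x N X Z u).
Proof.
move=> sX sY sZ Du.
have dY := smooth_row_derivable D oD n Y u (X u) sY Du.
have dZ := smooth_row_derivable D oD n Z u (X u) sZ Du.
rewrite (induced_connectionE X Y u sY Du) (induced_connectionE X Z u sZ Du).
have E p : D p -> associated_metric q x N p (Y p) (Z p) =
  ((fun p => ip q (Y p) (Z p)) + (fun p => 'D_(Y p) F p) * (fun p => 'D_(Z p) F p)) p.
  by move=> Dp; rewrite associated_metricE.
rewrite (derive_eq_on D _ _ oD E u (X u) Du).
have d1 := is_derive_ip q Y Z u (X u) dY dZ.
have d2 := is_deriveM (derive_dF u (X u) Y Du dY) (derive_dF u (X u) Z Du dZ).
rewrite (@derive_val _ _ _ _ _ _ _ (is_deriveD d1 d2)).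
have Ec := associated_metricC u (Y u) _ Du.
rewrite Ec !(associated_metric_grad _ _ _ _ Du) (ipC q ('D_(X u) Z u)) /GRing.scale/=.
move: (ip q _ _) (ip q _ _) (hess u _ _) (hess u _ _) => a b c d.
move: ('D_(Y u) F u) ('D_(Z u) F u) ('D_('D_(X u) Y u) F u) ('D_('D_(X u) Z u) F u) => *.

by field.
Qed.

(** The correction terms cancel by symmetry of the Hessian, leaving the flat bracket. *)
Lemma induced_connection_torsion X Y u :
  smooth_on D X -> smooth_on D Y -> D u ->
  induced_connection x N X Y u - induced_connection x N Y X u = lie_bracket X Y u.
Proof.
move=> sX sY Du.
rewrite (induced_connectionE X Y u sY Du) (induced_connectionE Y X u sX Du).
by rewrite [hess u (Y u) _]hessC// opprD addrACA subrr addr0.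
Qed.

Lemma monge_levi_civita :
  levi_civita D (associated_metric q x N) (induced_connection x N).
Proof.
split.
- exact: monge_semi_riemannian.
- exact: induced_connection_affine.
- exact: induced_connection_torsion.
- exact: induced_connection_metric.
Qed.

End Monge.

Theorem proposition5p1 (R : realType) (n q : nat) (hq : (0 < q <= n.+1)%N)
    (D : set 'rV[R]_n) (hD : open D)
    (F : 'rV[R]_n -> R) (hF : smooth_on D F) (hF0 : forall u, D u -> F u != 0)
    (hM : null_hypersurface q D (graph F)) :
  let x := graph F in
  let N := monge_rigging q F in
  null_rigging q D x N /\
  (* (1) *)
  (closed_form D (eta q x N) /\
   forall u v, D u -> rotation q x N u v = 0) /\
  (* (2) *)
  conformal_screen q D x N (fun=> 1) /\
  (* (3) *)
  (integrable_distribution D (screen q x N) /\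
   (forall c : R, integral_manifold D (screen q x N) (level_set D F c)) /\
   (forall L : set 'rV[R]_n, leaf D (screen q x N) L <->
      exists2 u, D u & L = connected_component (level_set D F (F u)) u)) /\
  (* (4) *)
  levi_civita D (associated_metric q x N) (induced_connection x N) /\
  (* (5) *)
  (forall X : 'rV[R]_n -> 'rV[R]_n, smooth_on D X ->
     forall u, D u ->
       divergence x N X u = \sum_(a < n) partial a (fun p => X p ord0 a) u).
Proof.
have [q0 _] := andP hq; move=> x N.
split; first exact: monge_null_rigging.
split; first by split; [exact: monge_closed|exact: rotationE].
split; first exact: monge_conformal.
split; first exact: monge_screen_leaves.
split; first exact: monge_levi_civita.
by move=> X sX u Du; exact: divergenceE sX Du.
Qed.
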